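(* $\vec T$ has a finite presentation with generators $\{g_1,g_2,g_3,c_0\}$ and relations \begin{align*} g_1^{-1}g_3g_1 &= g_2^{-1}g_3g_2\\ g_1^{-3}g_2g_1^3 &= g_3^{-1}g_1^{-2}g_2g_1^2g_3\\ g_1^{-2}g_3g_1^2 &= g_2^{-1}g_1^{-1}g_3g_1g_2\\ g_1^{-2}g_3g_1^2 &= g_3^{-1}g_1^{-1}g_3g_1g_3\\ g_1^{-2}g_2g_1^2 &= g_2^{-1}g_1^{-1}g_2g_1g_2\\ g_1^{-2}g_2g_1^2 &= g_3^{-1}g_1^{-1}g_2g_1g_3\\ c_2g_2 &= g_1c_4\\ c_2g_3 &= g_2c_4\\ c_4g_4 &= g_3c_6\\ c_0g_1 &= c_2^3\\ c_2g_1 &= c_4^3\\ c_0^2 &= 1 \end{align*} where the symbols $c_{2n}$ ($n\ge1$) and $g_n$ ($n\ge4$) abbreviate words in the generators defined inductively by $c_{2n}=g_{2n-1}^{-1}c_{2n-2}$ and $g_n=g_{n-3}^{-1}g_{n-2}g_{n-3}$. Here the generators correspond to the elements $g_k=x_{k-1}x_k$ ($k=1,2,3$) and $c_0=f_{\frac12}$ of $\vec T$.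
   Context: **Trees and $T$.** A full binary tree is a finite rooted plane tree in which every vertex has either $0$ children or $2$ children (a left and a right one); leaves are numbered $1,2,\dots$ from left to right. Associate $[0,1)$ with the root, and if $[a,b)$ is associated with a vertex, associate $[a,\frac{a+b}2)$ with its left child and $[\frac{a+b}2,b)$ with its right child. Given full binary trees $R,S$ with the same number $m$ of leaves and $1\le n\le m$, the triple $(R,S,n)$ represents the homeomorphism of the circle $[0,1]/(0\sim 1)$ which, for each $i$, maps the interval of leaf $i$ of $R$ affinely and increasingly onto the interval of leaf $i+n-1$ (taken mod $m$ in $\{1,\dots,m\}$) of $S$; leaf $i$ of $R$ is said to be identified with leaf $i+n-1$ of $S$. Thompson's group $T$ is the group of all homeomorphisms so represented; products are composed from left to right, $(fg)(t)=g(f(t))$. A triple is reduced if there is no caret in $R$ both of whose children are leaves that are identified (left with left, right with right) with the two leaf children of a caret of $S$; every element of $T$ has a unique reduced triple. **Thompson graphs.** For a full binary tree with leaves $l_1,\dots,l_m$ arranged on a horizontal line, its Thompson graph has vertices $v_1,\dots,v_m$ on that line, $v_1$ to the left of $l_1$ and $v_i$ between $l_{i-1}$ and $l_i$; for each left edge $e$ of the tree, the unique pair $v_i,v_j$ that can be joined by a path above the line crossing the tree only at $e$ is joined by an edge. (Equivalently: for each non-leaf vertex $p$, join $v_i$ to $v_j$ where $l_i$ is the leftmost leaf below the left child of $p$ and $l_j$ is the leftmost leaf below the right child of $p$.) The Thompson graph of $f\in T$ with reduced triple $(R,S,n)$ is obtained from the Thompson graphs of $R$ and $S$ by identifying their vertices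 in the same way as the leaves (the $i$th vertex for $R$ with the $(i+n-1)$st, mod $m$, for $S$). $\vec T$ is the subgroup of all $f\in T$ whose Thompson graph is bipartite. **Elements.** $x_0(t)=2t$ on $[0,\frac14)$, $t+\frac14$ on $[\frac14,\frac12)$, $\frac12t+\frac12$ on $[\frac12,1)$. For $n\ge1$, $x_n(t)=t$ on $[0,\frac12]$ and $x_n(t)=\frac{x_{n-1}(2t-1)+1}{2}$ on $(\frac12,1]$. $f_{\frac12}(t)=t+\frac12 \bmod 1$. *)

(* Defs.v *)
From HB Require Import structures.
From mathcomp Require Import all_boot all_order all_algebra.
From mathcomp Require Import boolp classical_sets reals.
From mathcomp Require Import lra.
Set Implicit Arguments.
Unset Strict Implicit.
Unset Printing Implicit Defensive.
Import Order.TTheory GRing.Theory Num.Theory.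
Local Open Scope ring_scope.

(* The letter (x, true) stands for x, and (x, false) for its inverse. *)
Definition word (X : Type) := seq (X * bool).

Definition wgen (X : Type) (x : X) : word X := [:: (x, true)].
Definition winv (X : Type) (w : word X) : word X :=
  rev [seq (l.1, ~~ l.2) | l <- w].
Definition wexp (X : Type) (w : word X) (n : nat) : word X :=
  flatten (nseq n w).

Declare Scope word_scope.
Delimit Scope word_scope with W.
Bind Scope word_scope with word.
Notation "u * v" := (cat u v) : word_scope.
Notation "u ^-1" := (winv u) : word_scope.
Notation "u ^+ n" := (wexp u n) : word_scope.
Notation "u ^- n" := (winv (wexp u n)) : word_scope.

Definition letter_val (G : groupType) (X : Type) (g : X -> G)
    (l : X * bool) : G :=
  if l.2 then g l.1 else ((g l.1)^-1)%g.

Definition word_val (G : groupType) (X : Type) (g : X -> G) (w : word X) : G :=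
  (\prod_(l <- w) letter_val g l)%g.

(* The least congruence on words containing free cancellation and rels; its
   classes are the elements of the group < X | rels >. *)
Inductive word_eq (X : eqType) (rels : seq (word X * word X)) :
    word X -> word X -> Prop :=
| WordRefl u : word_eq rels u u
| WordSym u v : word_eq rels u v -> word_eq rels v u
| WordTrans u v w : word_eq rels u v -> word_eq rels v w -> word_eq rels u w
| WordCat u u' v v' : word_eq rels u u' -> word_eq rels v v' ->
    word_eq rels (u ++ v) (u' ++ v')
| WordCancel x b : word_eq rels [:: (x, b); (x, ~~ b)] [::]
| WordRel u v : (u, v) \in rels -> word_eq rels u v.

(* x |-> g x induces a group isomorphism from < X | rels > onto H. In
   particular H is then a subgroup of G generated by the g x. *)
Definition finite_presentation (G : groupType) (H : set G) (X : finType)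
    (g : X -> G) (rels : seq (word X * word X)) : Prop :=
  (forall h : G, H h <-> exists w : word X, word_val g w = h) /\
  (forall u v : word X, word_val g u = word_val g v <-> word_eq rels u v).

(* The circle [0,1]/(0 ~ 1), a point being given by its representative
   in [0,1). *)
Definition circle (R : realType) := {t : R | 0 <= t < 1}.

Record circle_bij (R : realType) := CircleBij {
  cfun :> circle R -> circle R;
  cinv : circle R -> circle R;
  cfunK : cancel cfun cinv;
  cinvK : cancel cinv cfun }.

Section CircleBijGroup.
Variable R : realType.
Implicit Types f g h : circle_bij R.

Lemma circle_bijP f g : (forall t, f t = g t) -> f = g.
Proof.
case: f g => [f f' fK f'K] [g g' gK g'K] /= /funext fg.
move: fK f'K; rewrite {}fg => fK f'K.
have f'g' : f' = g' by apply/funext => t; rewrite -[t in LHS]g'K fK.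
move: fK f'K; rewrite {}f'g' => fK f'K.
by congr CircleBij; apply: Prop_irrelevance.
Qed.

Definition circle_one : circle_bij R :=
  @CircleBij R id id (fun=> erefl) (fun=> erefl).
(* f first, then g *)
Definition circle_mul f g : circle_bij R :=
  CircleBij (can_comp (cfunK g) (cfunK f)) (can_comp (cinvK f) (cinvK g)).
Definition circle_inv f : circle_bij R := CircleBij (cinvK f) (cfunK f).

Fact circle_mulA : associative circle_mul.
Proof. by move=> f g h; apply: circle_bijP. Qed.
Fact circle_mul1g : left_id circle_one circle_mul.
Proof. by move=> f; apply: circle_bijP. Qed.
Fact circle_mulg1 : right_id circle_one circle_mul.
Proof. by move=> f; apply: circle_bijP. Qed.
Fact circle_mulVg : left_inverse circle_one circle_inv circle_mul.
Proof. by move=> f; apply: circle_bijP => t /=; rewrite cinvK. Qed.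
Fact circle_mulgV : right_inverse circle_one circle_inv circle_mul.
Proof. by move=> f; apply: circle_bijP => t /=; rewrite cfunK. Qed.

HB.instance Definition _ := gen_eqMixin (circle_bij R).
HB.instance Definition _ := gen_choiceMixin (circle_bij R).
HB.instance Definition _ := isGroup.Build (circle_bij R)
  circle_mulA circle_mul1g circle_mulg1 circle_mulVg circle_mulgV.

End CircleBijGroup.

Inductive tree := Leaf | Node (l r : tree).

Fixpoint nleaves (t : tree) : nat :=
  if t is Node l r then (nleaves l + nleaves r)%N else 1%N.

(* The endpoints of the intervals of the leaves of t, from left to right, when
   [a, b) is associated with the root. *)
Fixpoint leaf_intervals (R : realType) (t : tree) (a b : R) : seq (R * R) :=
  if t is Node l r then
    leaf_intervals l a ((a + b) / 2) ++ leaf_intervals r ((a + b) / 2) b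
  else [:: (a, b)].

(* Leaves and graph vertices are numbered from 0, the first one having number
   k in the next two functions. *)

Fixpoint thompson_edges (t : tree) (k : nat) : seq (nat * nat) :=
  if t is Node l r then
    (k, k + nleaves l)%N
      :: thompson_edges l k ++ thompson_edges r (k + nleaves l)
  else [::].

(* The left leaves of the carets whose two children are leaves. *)
Fixpoint leaf_carets (t : tree) (k : nat) : seq nat :=
  match t with
  | Leaf => [::]
  | Node Leaf Leaf => [:: k]
  | Node l r => leaf_carets l k ++ leaf_carets r (k + nleaves l)
  end.

Record triple := Triple { dom_tree : tree; ran_tree : tree; shift : nat }.

Definition is_triple (D : triple) : Prop :=
  nleaves (dom_tree D) = nleaves (ran_tree D) /\
  (1 <= shift D <= nleaves (dom_tree D))%N.

(* Since leaves are numbered from 0 here, the rule i |-> i + n - 1 taken mod m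
   in {1, ..., m} becomes i |-> i + (n - 1) mod m in {0, ..., m - 1}. *)
Definition identified (D : triple) (i : nat) : nat :=
  ((i + (shift D).-1) %% nleaves (dom_tree D))%N.

Definition represents (R : realType) (D : triple) (f : circle_bij R) : Prop :=
  forall (i : nat) (t : circle R), (i < nleaves (dom_tree D))%N ->
    let I := nth (0, 0) (leaf_intervals (dom_tree D) 0 1) i in
    let J := nth (0, 0) (leaf_intervals (ran_tree D) 0 1) (identified D i) in
    I.1 <= val t < I.2 ->
    val (f t) = J.1 + (J.2 - J.1) / (I.2 - I.1) * (val t - I.1).

Definition reduced (D : triple) : Prop :=
  ~ exists i j : nat,
    [/\ i \in leaf_carets (dom_tree D) 0, j \in leaf_carets (ran_tree D) 0,
        identified D i = j & identified D i.+1 = j.+1].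

(* The edges of the graph on {0, ..., m - 1} obtained by gluing the Thompson
   graphs of the two trees; vertices are named as in the range tree. *)
Definition thompson_graph (D : triple) : seq (nat * nat) :=
  [seq (identified D e.1, identified D e.2)
     | e <- thompson_edges (dom_tree D) 0] ++ thompson_edges (ran_tree D) 0.

Definition bipartite (E : seq (nat * nat)) : Prop :=
  exists c : nat -> bool, forall e, e \in E -> c e.1 != c e.2.

(* Represented bijections are homeomorphisms of the circle, so it does no harm
   to work inside the group of all bijections. *)
Definition thompsonT (R : realType) : set (circle_bij R) :=
  [set f | exists D, is_triple D /\ represents D f].

Definition vecT (R : realType) : set (circle_bij R) :=
  [set f | thompsonT f /\
     exists D, [/\ is_triple D, reduced D, represents D f
                 & bipartite (thompson_graph D)]].
Arguments thompsonT : clear implicits.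
Arguments vecT : clear implicits.

Section Elements.
Variable R : realType.
Implicit Types (t : R) (n : nat).

Fixpoint x_fun n t : R :=
  if n is n'.+1 then
    if t <= 1 / 2 then t else (x_fun n' (2 * t - 1) + 1) / 2
  else if t < 1 / 4 then 2 * t
  else if t < 1 / 2 then t + 1 / 4
  else 1 / 2 * t + 1 / 2.

Fixpoint x_inv n t : R :=
  if n is n'.+1 then
    if t <= 1 / 2 then t else (x_inv n' (2 * t - 1) + 1) / 2
  else if t < 1 / 2 then 1 / 2 * t
  else if t < 3 / 4 then t - 1 / 4
  else 2 * t - 1.

Definition half_fun t : R := if t < 1 / 2 then t + 1 / 2 else t - 1 / 2.

Fact x_fun_circle n t : 0 <= t < 1 -> 0 <= x_fun n t < 1.
Proof.
elim: n t => [|n IHn] t /= t01.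
  by case: (ltP t) => ?; [|case: (ltP t) => ?]; lra.
case: (leP t) => ? //.
have /IHn : 0 <= 2 * t - 1 < 1 by lra.
by move=> ?; lra.
Qed.

Fact x_inv_circle n t : 0 <= t < 1 -> 0 <= x_inv n t < 1.
Proof.
elim: n t => [|n IHn] t /= t01.
  by case: (ltP t) => ?; [|case: (ltP t) => ?]; lra.
case: (leP t) => ? //.
have /IHn : 0 <= 2 * t - 1 < 1 by lra.
by move=> ?; lra.
Qed.

Fact half_fun_circle t : 0 <= t < 1 -> 0 <= half_fun t < 1.
Proof. by move=> t01; rewrite /half_fun; case: (ltP t) => ?; lra. Qed.

Fact x_fun_gt0 n t : 0 < t < 1 -> 0 < x_fun n t.
Proof.
elim: n t => [|n IHn] t /= t01.
  by case: (ltP t) => ?; [|case: (ltP t) => ?]; lra.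
case: (leP t) => ?; first lra.
have /IHn : 0 < 2 * t - 1 < 1 by lra.
by move=> ?; lra.
Qed.

Fact x_inv_gt0 n t : 0 < t < 1 -> 0 < x_inv n t.
Proof.
elim: n t => [|n IHn] t /= t01.
  by case: (ltP t) => ?; [|case: (ltP t) => ?]; lra.
case: (leP t) => ?; first lra.
have /IHn : 0 < 2 * t - 1 < 1 by lra.
by move=> ?; lra.
Qed.

Fact x_funK n t : 0 <= t < 1 -> x_inv n (x_fun n t) = t.
Proof.
elim: n t => [|n IHn] t /= t01.
  by case: (ltP t) => ?; [|case: (ltP t) => ?];
    case: ltP => ?; try lra; case: ltP => ?; lra.
case: (leP t) => t2; first by rewrite t2.
have t'01 : 0 < 2 * t - 1 < 1 by lra.
have x0 := @x_fun_gt0 n _ t'01.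
case: leP => [|_]; first lra.
rewrite [2 * _ - 1](_ : _ = x_fun n (2 * t - 1)); last lra.
by rewrite IHn; lra.
Qed.

Fact x_invK n t : 0 <= t < 1 -> x_fun n (x_inv n t) = t.
Proof.
elim: n t => [|n IHn] t /= t01.
  by case: (ltP t) => ?; [|case: (ltP t) => ?];
    case: ltP => ?; try lra; case: ltP => ?; lra.
case: (leP t) => t2; first by rewrite t2.
have t'01 : 0 < 2 * t - 1 < 1 by lra.
have x0 := @x_inv_gt0 n _ t'01.
case: leP => [|_]; first lra.
rewrite [2 * _ - 1](_ : _ = x_inv n (2 * t - 1)); last lra.
by rewrite IHn; lra.
Qed.

Fact half_funK t : 0 <= t < 1 -> half_fun (half_fun t) = t.
Proof.
by rewrite /half_fun => t01; case: (ltP t) => ?; case: ltP => ?; lra.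
Qed.

Definition lift_circle (F : R -> R)
    (HF : forall t, 0 <= t < 1 -> 0 <= F t < 1) (t : circle R) : circle R :=
  exist _ (F (val t)) (HF _ (valP t)).

Fact lift_circleK (F F' : R -> R) HF HF' :
  (forall t, 0 <= t < 1 -> F' (F t) = t) ->
  cancel (@lift_circle F HF) (@lift_circle F' HF').
Proof. by move=> K t; apply: val_inj; apply: K (valP t). Qed.

Definition x_ n : circle_bij R :=
  CircleBij (lift_circleK (@x_fun_circle n) (@x_inv_circle n) (@x_funK n))
            (lift_circleK (@x_inv_circle n) (@x_fun_circle n) (@x_invK n)).

Definition f_half : circle_bij R :=
  CircleBij (lift_circleK half_fun_circle half_fun_circle half_funK)
            (lift_circleK half_fun_circle half_fun_circle half_funK).

End Elements.

Inductive vgen := G1 | G2 | G3 | C0.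

Definition vgen_code (x : vgen) : 'I_4 :=
  inord (match x with G1 => 0 | G2 => 1 | G3 => 2 | C0 => 3 end).
Definition vgen_decode (i : 'I_4) : vgen :=
  match val i with 0 => G1 | 1 => G2 | 2 => G3 | _ => C0 end.
Fact vgen_codeK : cancel vgen_code vgen_decode.
Proof. by case; rewrite /vgen_decode /= inordK. Qed.
HB.instance Definition _ := Finite.copy vgen (can_type vgen_codeK).

Definition vgen_val (R : realType) (x : vgen) : circle_bij R :=
  match x with
  | G1 => x_ R 0 * x_ R 1
  | G2 => x_ R 1 * x_ R 2
  | G3 => x_ R 2 * x_ R 3
  | C0 => f_half R
  end%g.

(* The word g_n; g_0 is a dummy value. *)
Fixpoint g_ (n : nat) : word vgen :=
  match n with
  | 0 => [::]
  | 1 => wgen G1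
  | 2 => wgen G2
  | 3 => wgen G3
  | ((k.+1 as k1).+1 as k2).+2 => ((g_ k1)^-1 * g_ k2 * g_ k1)%W
  end.

(* c_ n is the word c_{2n}. *)
Fixpoint c_ (n : nat) : word vgen :=
  if n is k.+1 then ((g_ (2 * k).+1)^-1 * c_ k)%W else wgen C0.

Definition vecT_rels : seq (word vgen * word vgen) :=
  let g1 := wgen G1 in let g2 := wgen G2 in let g3 := wgen G3 in
  let c0 := wgen C0 in
  let g4 := g_ 4 in let c2 := c_ 1 in let c4 := c_ 2 in let c6 := c_ 3 in
  [:: (g1^-1 * g3 * g1, g2^-1 * g3 * g2);
      (g1^-3 * g2 * g1^+3, g3^-1 * g1^-2 * g2 * g1^+2 * g3);
      (g1^-2 * g3 * g1^+2, g2^-1 * g1^-1 * g3 * g1 * g2);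
      (g1^-2 * g3 * g1^+2, g3^-1 * g1^-1 * g3 * g1 * g3);
      (g1^-2 * g2 * g1^+2, g2^-1 * g1^-1 * g2 * g1 * g2);
      (g1^-2 * g2 * g1^+2, g3^-1 * g1^-1 * g2 * g1 * g3);
      (c2 * g2, g1 * c4);
      (c2 * g3, g2 * c4);
      (c4 * g4, g3 * c6);
      (c0 * g1, c2^+3);
      (c2 * g1, c4^+3);
      (c0^+2, [::])]%W.

(* Main.v *)
Require Import Defs.
From Stdlib Require List.
From HB Require Import structures.
From mathcomp Require Import all_boot all_order all_algebra.
From mathcomp Require Import boolp classical_sets reals.
From mathcomp Require Import zify ring lra.
Set Implicit Arguments.
Unset Strict Implicit.
Unset Printing Implicit Defensive.

(* Let the colour of a leaf interval [a, b) be the parity of the binary digit sum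
   of a. The Thompson graph of a tree is a tree properly coloured in this way, so
   a triple has a bipartite graph iff its element preserves all colours or
   reverses all of them. Subdividing the two trees of such a triple compatibly, we
   can make the first one a pair of ternary trees hanging from the two halves of
   the circle, where a ternary caret splits an interval into its left half and the
   two halves of its right half. Colours then alternate around the circle; as this
   is inherited by the second tree, that one must be of the same form. Hence vecT
   is a copy of the group of Thompson type acting on ternary subdivisions of a
   circle made of two intervals.

   As for Thompson's T, the given relations imply
     g_k^-1 g_n g_k = g_(n+2) (k < n),  c_(2n) g_(k+1) = g_k c_(2n+2) (k <= 2n),
     c_(2n) g_1 = c_(2n+2)^3  and  c_(2n)^(2n+2) = 1,
   which allow us to write every word as p c_(2n)^s q^-1 with p and q positive
   words read off two ternary forests. If such a word represents 1, then the two
   forests are equal and s is 0, so the word is trivial already in the presented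
   group. *)

(** * Words and presented groups *)

Section WordVal.
Variables (G : groupType) (X : Type) (g : X -> G).
Implicit Types u v w : word X.
Local Open Scope group_scope.

Lemma word_val_nil : word_val g [::] = 1.
Proof. by rewrite /word_val big_nil. Qed.

Lemma word_val_cat u v : word_val g (u ++ v) = word_val g u * word_val g v.
Proof. by rewrite /word_val big_cat. Qed.

Lemma word_val_gen x : word_val g (wgen x) = g x.
Proof. by rewrite /word_val big_seq1. Qed.

Lemma word_val_inv w : word_val g (winv w) = (word_val g w)^-1.
Proof.
elim: w => [|[x b] w IHw]; first by rewrite word_val_nil invg1.
rewrite /winv /= rev_cons -cats1 word_val_cat -/(winv w) IHw.
rewrite -[(x, b) :: w]cat1s word_val_cat invgM; congr (_ * _).
by rewrite /word_val !big_seq1 /letter_val; case: b; rewrite ?invgK.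
Qed.

Lemma word_val_exp w n : word_val g (wexp w n) = word_val g w ^+ n.
Proof.
elim: n => [|n IHn]; first by rewrite word_val_nil.
by rewrite /wexp /= word_val_cat IHn expgS.
Qed.

End WordVal.

Definition word_valE := (word_val_cat, word_val_inv, word_val_exp,
  word_val_gen, word_val_nil).

(** Kept general in the group: it is applied both to the circle bijections and to the presented
    group itself. *)
Definition satisfies (G : groupType) (X : eqType) (g : X -> G)
    (rels : seq (word X * word X)) :=
  forall u v, (u, v) \in rels -> word_val g u = word_val g v.

Lemma word_eq_val (G : groupType) (X : eqType) (g : X -> G) rels u v :
  satisfies g rels -> word_eq rels u v -> word_val g u = word_val g v.
Proof.
move=> sat; elim=> {u v} // [u v w _ -> _ -> //|u u' v v' _ Eu _ Ev|x b].
  by rewrite !word_val_cat Eu Ev.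
rewrite -cat1s word_val_cat /word_val !big_seq1 big_nil /letter_val /=.
by case: b; rewrite /= ?mulgV ?mulVg.
Qed.

Section Presented.
Local Open Scope quotient_scope.
Variables (X : choiceType) (rels : seq (word X * word X)).
Implicit Types u v w : word X.

Lemma winvK : involutive (@winv X).
Proof.
move=> w; rewrite /winv map_rev revK -map_comp -[RHS]map_id.
by apply: eq_map => -[x b] /=; rewrite negbK.
Qed.

Lemma word_eq_mulwV w : word_eq rels (w ++ winv w) [::].
Proof.
elim: w => [|[x b] w IHw]; first exact: WordRefl.
rewrite /winv /= rev_cons -cats1 catA -/(winv w).
apply: WordTrans (WordCancel rels x b).
apply: (WordCat (WordRefl _ [:: (x, b)])).
exact: (WordCat IHw (WordRefl _ [:: (x, ~~ b)])).
Qed.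

Lemma word_eq_mulVw w : word_eq rels (winv w ++ w) [::].
Proof. by rewrite -{2}[w]winvK; apply: word_eq_mulwV. Qed.

(** The congruence has no rule for inverses, but u^-1 = u^-1 v v^-1 = u^-1 u v^-1 = v^-1. *)
Lemma word_eq_inv u v : word_eq rels u v -> word_eq rels (winv u) (winv v).
Proof.
move=> uv; rewrite -[winv u]cats0 -[winv v]cat0s.
apply: WordTrans (WordCat (word_eq_mulVw u) (WordRefl _ _)).
rewrite -catA; apply: WordCat (WordRefl _ _) _.
apply: WordTrans (WordCat (WordSym uv) (WordRefl _ _)).
exact: WordSym (word_eq_mulwV v).
Qed.

Definition word_eqb : rel (word X) := fun u v => `[< word_eq rels u v >].

Fact word_eqb_equiv : equiv_class_of word_eqb.
Proof.
split=> [u|u v|v u w]; first exact/asboolP/WordRefl.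
  by apply/asboolP/asboolP => ?; apply: WordSym.
by move=> /asboolP uv /asboolP vw; apply/asboolP; apply: WordTrans uv vw.
Qed.
Canonical word_eqb_equiv_rel := EquivRelPack word_eqb_equiv.

(** Turning < X | rels > into a [groupType] lets every consequence of the relations be derived by
    ordinary group computations. *)
Definition presented := {eq_quot word_eqb}.
HB.instance Definition _ := Choice.on presented.

Definition wclass w : presented := \pi_{eq_quot word_eqb} w.

Lemma wclassP u v : wclass u = wclass v <-> word_eq rels u v.
Proof. by split=> [/eqmodP/asboolP //|uv]; apply/eqmodP/asboolP. Qed.

Lemma wclass_repr (a : presented) : wclass (repr a) = a.
Proof. exact: reprK. Qed.

Lemma repr_wclass w : word_eq rels (repr (wclass w)) w.
Proof. by apply/wclassP; rewrite wclass_repr. Qed.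

Definition presented_mul (a b : presented) := wclass (repr a ++ repr b).
Definition presented_inv (a : presented) := wclass (winv (repr a)).

Lemma presented_mulE u v : presented_mul (wclass u) (wclass v) = wclass (u ++
  v).
Proof. by apply/wclassP; apply: WordCat; apply: repr_wclass. Qed.

Lemma presented_invE u : presented_inv (wclass u) = wclass (winv u).
Proof. by apply/wclassP; apply/word_eq_inv/repr_wclass. Qed.

Fact presented_mulA : associative presented_mul.
Proof.
move=> a b c; rewrite -[a]wclass_repr -[b]wclass_repr -[c]wclass_repr.
by rewrite !presented_mulE catA.
Qed.
Fact presented_mul1g : left_id (wclass [::]) presented_mul.
Proof. by move=> a; rewrite -[a]wclass_repr presented_mulE. Qed.
Fact presented_mulg1 : right_id (wclass [::]) presented_mul.
Proof. by move=> a; rewrite -[a]wclass_repr presented_mulE cats0. Qed.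
Fact presented_mulVg : left_inverse (wclass [::]) presented_inv presented_mul.
Proof.
move=> a; rewrite -[a]wclass_repr presented_invE presented_mulE.
exact/wclassP/word_eq_mulVw.
Qed.
Fact presented_mulgV : right_inverse (wclass [::]) presented_inv presented_mul.
Proof.
move=> a; rewrite -[a]wclass_repr presented_invE presented_mulE.
exact/wclassP/word_eq_mulwV.
Qed.

HB.instance Definition _ := isGroup.Build presented
  presented_mulA presented_mul1g presented_mulg1 presented_mulVg
    presented_mulgV.

Definition presented_gen (x : X) : presented := wclass (wgen x).

Lemma presented_val w : word_val presented_gen w = wclass w.
Proof.
elim: w => [|[x b] w IHw]; first by rewrite word_val_nil.
rewrite -cat1s word_val_cat IHw -[RHS]presented_mulE; congr (_ * _)%g.
rewrite /word_val big_seq1 /letter_val; case: b => //=.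
exact: presented_invE.
Qed.

Lemma presented_valP u v :
  word_val presented_gen u = word_val presented_gen v <-> word_eq rels u v.
Proof. by rewrite !presented_val; apply: wclassP. Qed.

Lemma presented_satisfies : satisfies presented_gen rels.
Proof. by move=> u v uv; apply/presented_valP; apply: WordRel. Qed.

End Presented.

(** * Consequences of the relations *)

Section Relations.
Variables (G : groupType) (v : vgen -> G).
Hypothesis sat : satisfies v vecT_rels.
Local Open Scope group_scope.

Local Notation gam n := (word_val v (g_ n)).
Local Notation rho n := (word_val v (c_ n)).

Lemma gam4 n : gam n.+4 = gam n.+2 ^ gam n.+1.
Proof. by rewrite [g_ _]/= !word_valE conjgE mulgA. Qed.

Lemma rhoS n : rho n = gam (2 * n).+1 * rho n.+1.
Proof. by rewrite [c_ n.+1]/= !word_valE mulVKg. Qed.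

Let rel i := nth ([::], [::]) vecT_rels i.

Let relP i : i < 12 -> word_val v (rel i).1 = word_val v (rel i).2.
Proof. by move=> i12; apply: sat; rewrite -surjective_pairing mem_nth. Qed.

(** These are the first six relations, once their inner conjugates are written as g_4, g_5 and
    g_6. *)
Lemma gam_conj_base :
  [/\ gam 3 ^ gam 1 = gam 5, gam 4 ^ gam 1 = gam 6, gam 4 ^ gam 2 = gam 6,
      gam 6 ^ gam 1 = gam 6 ^ gam 3
    & gam 5 ^ gam 1 = gam 5 ^ gam 2 /\ gam 5 ^ gam 1 = gam 5 ^ gam 3].
Proof.
have E : (gam 4 = gam 2 ^ gam 1) * (gam 5 = gam 3 ^ gam 2)
         * (gam 6 = gam 4 ^ gam 3) by rewrite !gam4.
have R0 : gam 3 ^ gam 1 = gam 5.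
  rewrite !E; have := @relP 0 isT; rewrite !word_valE !conjgE ?mulgA.
  exact.
have R3 : gam 4 ^ gam 1 = gam 6.
  rewrite !E -!conjgM; have := @relP 5 isT.
  rewrite !word_valE !conjgE !invgM !mulgA; exact.
have R4 : gam 4 ^ gam 2 = gam 6.
  rewrite -R3 !E -!conjgM; have /esym := @relP 4 isT.
  rewrite !word_valE !conjgE !invgM !mulgA; exact.
split=> //; last split.
- rewrite -R3 E -!conjgM; have := @relP 1 isT.
  rewrite !word_valE !conjgE !invgM !mulgA; exact.
- rewrite -R0 -!conjgM; have := @relP 2 isT.
  rewrite !word_valE !conjgE !invgM !mulgA; exact.
- rewrite -R0 -!conjgM; have := @relP 3 isT.
  rewrite !word_valE !conjgE !invgM !mulgA; exact.
Qed.

(** The case k = n - 1 is the definition of g_(n+2). For large n, write g_n as a conjugate of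
    g_(n-2) by some g_j and use (a^b)^c = (a^c)^(b^c) to fall back on smaller indices. *)
Lemma gam_conj n k : 0 < k < n -> gam n ^ gam k = gam n.+2.
Proof.
have [R0 R3 R4 R1 [R2 R2']] := gam_conj_base.
have E2 : gam 2 ^ gam 1 = gam 4 by rewrite (gam4 0).
have E3 : gam 3 ^ gam 2 = gam 5 by rewrite (gam4 1).
have E4 : gam 4 ^ gam 3 = gam 6 by rewrite (gam4 2).
have E5 : gam 5 ^ gam 4 = gam 7 by rewrite (gam4 3).
have E6 : gam 6 ^ gam 5 = gam 8 by rewrite (gam4 4).
have R5 : gam 5 ^ gam 1 = gam 7 by rewrite -E5 -{1}E3 conjJg E2 R0.
have R6 : gam 6 ^ gam 1 = gam 8 by rewrite -E6 -{1}E4 conjJg R3 R0.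
have [m] := ubnP n; elim: m n k => // m IHm n k nm /andP[k0 kn].
have [n7|n7] := ltnP n 7.
  move: n7 k0 kn; case: n nm => [|[|[|[|[|[|[|n]]]]]]] // _ _;
    case: k => [|[|[|[|[|[|k]]]]]] // _ _.
  - by rewrite -R2.
  - by rewrite -R2'.
  - by rewrite -E6 -{1}E4 conjJg R4 E3.
  - by rewrite -R1.
  - by rewrite -{1}R3 -{2}E2 -conjJg R4.
case: n => [|[|n]] // in nm n7 kn *.
have IH j : 0 < j < n -> gam n ^ gam j = gam n.+2 by move=> jn;
  apply: IHm => //; lia.
(* Here g_(n+2) is g_n conjugated by g_(n-1); conjugating both by g_1 gives the defining conjugate
   of g_(n+4). *)
have n1 : gam n.+2 ^ gam 1 = gam n.+4.
  rewrite -(IH n.-1); last by lia.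
  rewrite conjJg IH; last by lia.
  rewrite (IHm n.-1); [|lia..].
  by rewrite (_ : n.-1.+2 = n.+1) -?gam4 //; lia.
(* Both g_(n+2) and g_(j+2) are conjugates by g_1, of g_n and g_j, so the conjugation by g_1 can be
   pulled out. *)
have conjS j : 1 < j < n -> gam n.+2 ^ gam j.+2 = gam n.+4.
  move=> jn; rewrite -{1}(IH 1%N); last by lia.
  by rewrite -(IHm j 1%N) -?conjJg ?IH //; lia.
case: k k0 kn => [|[|[|[|k]]]] // _ kn.
(* For k = 2 and k = 3, writing g_(n+2) as g_n conjugated by g_(k+1) replaces k by k + 3, which
   [conjS] covers. *)
- rewrite -{1}(IH 3); last by lia.
  by rewrite conjJg IH ?(IHm 3) ?conjS //; lia.
- rewrite -{1}(IH 4); last by lia.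
  by rewrite conjJg IH ?(IHm 4) ?conjS //; lia.
- by rewrite conjS //; lia.
Qed.

Lemma gam_comm n k : 0 < k < n -> gam n * gam k = gam k * gam n.+2.
Proof. by move=> /gam_conj <-; rewrite conjgC. Qed.

Lemma rho_gam n k : 0 < k <= 2 * n -> rho n * gam k.+1 = gam k * rho n.+1.
Proof.
elim: n k => [|n IHn] k kn; first by lia.
case: n => [|n] in IHn kn *.
  case: k kn => [|[|[|k]]] // _.
    by have := @relP 6 isT; rewrite !word_val_cat.
  by have := @relP 7 isT; rewrite !word_val_cat.
(* Put c_(2n+4) = g_(2n+3)^-1 c_(2n+2), apply induction, and expand the resulting c_(2n+4); moving
   g_(2n+3) past g_j cancels it. *)
have low j : 0 < j <= 2 * n.+1 -> rho n.+2 * gam j.+1 = gam j * rho n.+3.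
  move=> jn; rewrite -[rho n.+2](mulKg (gam (2 * n.+1).+1)) -rhoS.
  rewrite -mulgA IHn // rhoS !mulgA; congr (_ * _).
  rewrite -[LHS]mulgA (_ : (2 * n.+2).+1 = (2 * n.+1).+3); last by lia.
  by rewrite -gam_comm ?mulKg //; lia.
have [k4|k3] := leqP 4 k; last first.
  have [|k2] := leqP k (2 * n.+1); first by move=> ?; apply: low; lia.
  have [-> ->] : n = 0 /\ k = 3 by lia.
  by have := @relP 8 isT; rewrite !word_val_cat.
(* With k + 2 for the former k: g_(k+3) is g_(k+1) conjugated by g_2, and c_(2n+4) g_2^-1 = g_1^-1
   c_(2n+2). Induction then handles g_(k+1), and [low] the trailing g_2. *)
case: k => [|[|k]] // in kn k4 *.
rewrite -(@gam_conj k.+1 2) 1?[in RHS]gam_comm; [|lia..].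
rewrite -(@gam_conj k 1%N); last by lia.
rewrite !conjgE !mulgA.
have -> : rho n.+2 * (gam 2)^-1 = (gam 1)^-1 * rho n.+1.
  by apply: (mulIg (gam 2)); rewrite mulgVK -mulgA IHn ?mulKg //; lia.
rewrite -[_ * rho n.+1 * _]mulgA IHn; last by lia.
by rewrite -!mulgA low //; lia.
Qed.

Lemma rho_gam1 n : rho n * gam 1 = rho n.+1 ^+ 3.
Proof.
elim: n => [|n IHn].
  by have := @relP 9 isT; rewrite word_val_exp word_val_cat.
(* After multiplying by g_(2n+1), both sides become c_(2n+2)^3: on the right, g_(2n+1) moves through
   two factors c_(2n+4), gaining 1 each time, and is absorbed by the third. *)
apply: (mulgI (gam (2 * n).+1)); rewrite mulgA -rhoS IHn expgS expg2.
rewrite [in RHS]expgS expg2 [RHS]mulgA -rho_gam; last by lia.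
rewrite -[RHS]mulgA [X in _ = _ * X]mulgA -rho_gam; last by lia.
rewrite -[X in _ = _ * X]mulgA; do 2 congr (_ * _).
by rewrite [LHS]rhoS (_ : (2 * n.+1).+1 = (2 * n).+3) //; lia.
Qed.

Lemma gam1_rho n s : s <= 2 * n -> gam 1 * rho n.+1 ^+ s.+1 = rho n ^+ s * gam
  s.+1 * rho n.+1.
Proof.
elim: s => [|s IHs] sn; first by rewrite expg0 mul1g expg1.
rewrite expgSr mulgA IHs; last by lia.
rewrite -[X in X * _]mulgA -rho_gam; last by lia.
by rewrite expgSr !mulgA.
Qed.

(** By induction, c_(2n+2)^(2n+4) = c_(2n) g_1 c_(2n+2)^(2n+1) = c_(2n)^(2n+1) g_(2n+1) c_(2n+2) =
    c_(2n)^(2n+2). *)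
Lemma rho_order n : rho n ^+ (2 * n).+2 = 1.
Proof.
elim: n => [|n IHn].
  by have := @relP 11 isT; rewrite word_val_exp word_val_nil.
rewrite (_ : (2 * n.+1).+2 = 3 + (2 * n).+1) ?expgnDr -?rho_gam1; last by lia.
by rewrite -mulgA gam1_rho // -mulgA -rhoS -expgSr -expgS.
Qed.

End Relations.

(** * Ternary forests and normal forms *)

(** Iterated refinement, shared by ternary trees, forests and binary trees; the label of a step is
    the number of the leaf that is split, from 0. *)
Inductive reach (T : Type) (st : T -> nat -> T -> Prop) : T -> T -> Prop :=
| ReachRefl x : reach st x x
| ReachStep x i y z : st x i y -> reach st y z -> reach st x z.

Lemma reach_trans T (st : T -> nat -> T -> Prop) x y z :
  reach st x y -> reach st y z -> reach st x z.
Proof. by elim=> // {}x i u w xu _ IH /IH; apply: ReachStep xu. Qed.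

Lemma reach_map T T' (st : T -> nat -> T -> Prop) st' (f : T -> T') x y :
    (forall x i y, st x i y -> exists j, st' (f x) j (f y)) ->
  reach st x y -> reach st' (f x) (f y).
Proof.
move=> fst; elim=> [{}x|{}x i u w /fst[j xu] _ IH]; first exact: ReachRefl.
exact: ReachStep xu IH.
Qed.

Inductive otree := OLeaf | ONode (a b c : otree).

Fixpoint carets (t : otree) : nat :=
  if t is ONode a b c then (carets a + carets b + carets c).+1 else 0.

Definition oleaves (t : otree) : nat := (2 * carets t).+1.

Definition ocaret : otree := ONode OLeaf OLeaf OLeaf.

Inductive ostep : otree -> nat -> otree -> Prop :=
| OStepLeaf : ostep OLeaf 0 ocaret
| OStepL a b c i a' : ostep a i a' -> ostep (ONode a b c) i (ONode a' b c)
| OStepM a b c i b' : ostep b i b' ->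
    ostep (ONode a b c) (oleaves a + i) (ONode a b' c)
| OStepR a b c i c' : ostep c i c' ->
    ostep (ONode a b c) (oleaves a + oleaves b + i) (ONode a b c').

Lemma ostep_carets t i t' : ostep t i t' -> carets t' = (carets t).+1.
Proof. by elim=> //= *; lia. Qed.

Lemma ostep_lt t i t' : ostep t i t' -> i < oleaves t.
Proof. by elim; rewrite /oleaves //= => *; lia. Qed.

Lemma ostep_exists t i : i < oleaves t -> exists t', ostep t i t'.
Proof.
elim: t i => [|a IHa b IHb c IHc] i; rewrite /oleaves /= => it.
  by case: i it => // _; exists ocaret; apply: OStepLeaf.
have [ia|ai] := ltnP i (oleaves a).
  by have [a' aa'] := IHa i ia; exists (ONode a' b c); apply: OStepL.
have [ib|bi] := ltnP i (oleaves a + oleaves b).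
  have [|b' bb'] := IHb (i - oleaves a); first by lia.
  exists (ONode a b' c); rewrite -(subnKC ai); exact: OStepM.
have [|c' cc'] := IHc (i - (oleaves a + oleaves b)).
  by rewrite /oleaves in bi *; lia.
exists (ONode a b c'); rewrite -(subnKC bi); exact: OStepR.
Qed.

Lemma oreach_node a b c a' b' c' :
    reach ostep a a' -> reach ostep b b' -> reach ostep c c' ->
  reach ostep (ONode a b c) (ONode a' b' c').
Proof.
move=> aa' bb' cc'; apply: (@reach_trans _ _ _ (ONode a' b c)).
  apply: (reach_map _ aa' (f := fun t => ONode t b c)) => x i y xy.
  by exists i; apply: OStepL.
apply: (@reach_trans _ _ _ (ONode a' b' c)).
  apply: (reach_map _ bb' (f := fun t => ONode a' t c)) => x i y xy.
  by eexists; apply: OStepM xy.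
apply: (reach_map _ cc' (f := fun t => ONode a' b' t)) => x i y xy.
by eexists; apply: OStepR xy.
Qed.

Lemma oreach_leaf t : reach ostep OLeaf t.
Proof.
elim: t => [|a IHa b IHb c IHc]; first exact: ReachRefl.
exact: ReachStep OStepLeaf (oreach_node IHa IHb IHc).
Qed.

Lemma oreach_join t t' : exists2 u, reach ostep t u & reach ostep t' u.
Proof.
elim: t t' => [|a IHa b IHb c IHc] [|a' b' c'].
- by exists OLeaf; apply: ReachRefl.
- by exists (ONode a' b' c'); [apply: oreach_leaf|apply: ReachRefl].
- by exists (ONode a b c); [apply: ReachRefl|apply: oreach_leaf].
- have [[u au a'u] [w bw b'w]] := (IHa a', IHb b').
  by have [x cx c'x] := IHc c'; exists (ONode u w x); apply: oreach_node.
Qed.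

(* The two trees hang from the halves [0, 1/2) and [1/2, 1) of the circle. *)
Definition forest := (otree * otree)%type.

Section Forests.
Implicit Types A B E : forest.

Definition fcarets A : nat := carets A.1 + carets A.2.
Definition fleaves A : nat := oleaves A.1 + oleaves A.2.

Lemma fleavesE A : fleaves A = (2 * fcarets A).+2.
Proof. by rewrite /fleaves /fcarets /oleaves; lia. Qed.

Inductive fstep : forest -> nat -> forest -> Prop :=
| FStepL l i l' r : ostep l i l' -> fstep (l, r) i (l', r)
| FStepR l r i r' : ostep r i r' -> fstep (l, r) (oleaves l + i) (l, r').

Lemma fstep_carets A i A' : fstep A i A' -> fcarets A' = (fcarets A).+1.
Proof. by case=> ? ? ? ? /ostep_carets; rewrite /fcarets /= => ->; lia. Qed.

Lemma fstep_lt A i A' : fstep A i A' -> i < fleaves A.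
Proof. by case=> ? ? ? ? /ostep_lt; rewrite /fleaves /oleaves /=; lia. Qed.

Lemma fstep_exists A i : i < fleaves A -> exists A', fstep A i A'.
Proof.
case: A => l r; rewrite /fleaves /= => iA.
have [il|li] := ltnP i (oleaves l).
  by have [l' ll'] := ostep_exists il; exists (l', r); apply: FStepL.
have [|r' rr'] := @ostep_exists r (i - oleaves l); first by lia.
by exists (l, r'); rewrite -(subnKC li); apply: FStepR.
Qed.

Lemma freach_pair l r l' r' : reach ostep l l' -> reach ostep r r' ->
  reach fstep (l, r) (l', r').
Proof.
move=> ll' rr'; apply: (@reach_trans _ _ _ (l', r)).
  apply: (reach_map _ ll' (f := fun t => (t, r))) => x i y xy.
  by exists i; apply: FStepL.
apply: (reach_map _ rr' (f := fun t => (l', t))) => x i y xy.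
by eexists; apply: FStepR xy.
Qed.

Definition root_forest : forest := (OLeaf, OLeaf).

Lemma freach_roots A : reach fstep root_forest A.
Proof. by case: A => l r; apply: freach_pair; apply: oreach_leaf. Qed.

Lemma freach_join A B : exists2 E, reach fstep A E & reach fstep B E.
Proof.
case: A B => l r [l' r']; have [u lu l'u] := oreach_join l l'.
by have [w rw r'w] := oreach_join r r'; exists (u, w); apply: freach_pair.
Qed.

(* pos t k stands for the element replacing the k-th leaf of the infinite right
   vine by t; spos t k is the same when t hangs at the end of a finite vine,
   where carets added on the right spine only lengthen the vine. *)
Fixpoint pos (t : otree) (k : nat) : word vgen :=
  if t is ONode a b c then g_ k.+1 ++ pos c k.+2 ++ pos b k.+1 ++ pos a k
  else [::].

Fixpoint spos (t : otree) (k : nat) : word vgen :=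
  if t is ONode a b c then spos c k.+2 ++ pos b k.+1 ++ pos a k else [::].

Definition fpos A : word vgen := spos A.2 1 ++ pos A.1 0.

Definition normal_word A (s : nat) B : word vgen :=
  fpos A ++ wexp (c_ (fcarets A)) s ++ winv (fpos B).

End Forests.

Arguments g_ : simpl never.

(** * Normal words and their multiplication *)

Section NormalForm.
Variables (G : groupType) (v : vgen -> G).
Implicit Types (A B C D E : forest) (w : word vgen).
Hypothesis sat : satisfies v vecT_rels.
Local Open Scope group_scope.

Local Notation gam n := (word_val v (g_ n)).
Local Notation rho n := (word_val v (c_ n)).
Local Notation pos_ t k := (word_val v (pos t k)).
Local Notation spos_ t k := (word_val v (spos t k)).
Local Notation fpos_ A := (word_val v (fpos A)).

(** The element g_n splits leaf n - 1 of the vine. Hanging [t] at the earlier leaf k adds two leaves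
    per caret before it, which shifts the index accordingly. *)
Lemma gam_pos t n k : k.+1 < n ->
  gam n * pos_ t k = pos_ t k * gam (n + 2 * carets t).
Proof.
elim: t n k => [|a IHa b IHb c IHc] n k kn.
  by rewrite /= word_val_nil mulg1 mul1g addn0.
rewrite /= !word_val_cat !mulgA (gam_comm sat); last by lia.
rewrite -!mulgA; congr (_ * _); rewrite !mulgA IHc; last by lia.
rewrite -!mulgA; congr (_ * _); rewrite !mulgA IHb; last by lia.
rewrite -!mulgA; congr (_ * _); rewrite IHa; last by lia.
by congr (_ * gam _); lia.
Qed.

Lemma ostep_pos t i t' k : ostep t i t' -> pos_ t' k = pos_ t k * gam (k +
  i).+1.
Proof.
move=> tt'; elim: tt' k => {t i t'} [|a b c i a' _ IH|a b c i b' _ IH|a b c i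
  c' _ IH] k.
- by rewrite /= cats0 word_val_nil mul1g addn0.
- by rewrite /= !word_val_cat IH !mulgA.
- rewrite /= !word_val_cat IH -!mulgA gam_pos; last by lia.
  by do 4 congr (_ * _); congr (gam _); rewrite /oleaves; lia.
- rewrite /= !word_val_cat IH -!mulgA [X in _ * (_ * X) = _]mulgA gam_pos;
    last by lia.
  rewrite -mulgA gam_pos; last by lia.
  by do 4 congr (_ * _); congr (gam _); rewrite /oleaves; lia.
Qed.

(** The index [2 * carets t] is that of the rightmost leaf; a caret there only lengthens the vine
    and contributes the factor 1. *)
Lemma ostep_spos t i t' k : ostep t i t' ->
  spos_ t' k = spos_ t k * (if i < 2 * carets t then gam (k + i).+1 else 1).
Proof.
move=> tt'; elim: tt' k => {t i t'} [|a b c i a' aa' IH|a b c i b' bb' IH|a b c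
  i c' cc' IH] k.
- by rewrite /= word_val_nil mul1g.
- have := ostep_lt aa'; rewrite /= /oleaves !word_val_cat (ostep_pos _ aa') =>
    ?.
  by rewrite ifT ?mulgA //; lia.
- have := ostep_lt bb'; rewrite /= /oleaves !word_val_cat (ostep_pos _ bb') =>
    ?.
  rewrite ifT; last by lia.
  rewrite -!mulgA gam_pos; last by lia.
  by do 3 congr (_ * _); congr (gam _); lia.
- have := ostep_lt cc'; rewrite /= /oleaves !word_val_cat IH => ?.
  case: ltnP => ic; last by rewrite ifF ?mulg1 ?mulgA //; lia.
  rewrite ifT; last by lia.
  rewrite -!mulgA [X in _ * X = _]mulgA gam_pos; last by lia.
  rewrite -mulgA gam_pos; last by lia.
  by do 3 congr (_ * _); congr (gam _); lia.
Qed.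

(** The factor contributed by a caret at leaf i of a forest with n carets; it is trivial at the last
    leaf, number 2n + 1. *)
Definition caret_val n i : G := if i < (2 * n).+1 then gam i.+1 else 1.

Lemma fstep_pos A i A' : fstep A i A' ->
  fpos_ A' = fpos_ A * caret_val (fcarets A) i.
Proof.
rewrite /caret_val /fcarets /fpos => -[l {}i l' r ll'|l r {}i r' rr'] /=.
  rewrite !word_val_cat (ostep_pos _ ll') ifT ?mulgA //.
  by have := ostep_lt ll'; rewrite /oleaves; lia.
have ri := ostep_lt rr'; rewrite /oleaves in ri *.
rewrite !word_val_cat (ostep_spos _ rr').
case: ltnP => ir; last by rewrite mulg1 ifF ?mulg1 //; lia.
rewrite ifT; last by lia.
by rewrite -!mulgA gam_pos //; do 2 congr (_ * _); congr (gam _); lia.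
Qed.

Lemma rho_caret1 n i : i < (2 * n).+2 -> exists e,
  rho n * caret_val n (i.+1 %% (2 * n).+2) = caret_val n i * rho n.+1 ^+ e.
Proof.
rewrite ltnS leq_eqVlt => /orP[/eqP->|i_lt].
  (* The split leaf crosses the base point here, so its three parts have to be rotated past it. *)
  by exists 3; rewrite modnn /caret_val /= ltnn mul1g (rho_gam1 sat).
exists 1%N; rewrite modn_small ?expg1 // /caret_val i_lt ltnS.
move: i_lt; rewrite ltnS leq_eqVlt => /orP[/eqP->|i_lt].
  by rewrite ltnn mulg1 -rhoS.
by rewrite i_lt (rho_gam sat).
Qed.

Lemma rho_caret n s i : i < (2 * n).+2 -> exists e,
  rho n ^+ s * caret_val n ((i + s) %% (2 * n).+2)
  = caret_val n i * rho n.+1 ^+ e.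
Proof.
move=> i_lt; elim: s => [|s [e IHs]].
  by exists 0; rewrite addn0 modn_small // expg0 mul1g mulg1.
have [|d Ed] := @rho_caret1 n ((i + s) %% (2 * n).+2); first exact: ltn_pmod.
exists (e + d); rewrite expgSr -mulgA addnS.
have -> : (i + s).+1 %% (2 * n).+2 = ((i + s) %% (2 * n).+2).+1 %% (2 * n).+2.
  by rewrite -addn1 -modnDml addn1.
by rewrite Ed mulgA IHs -mulgA expgnDr.
Qed.

Lemma normal_valE A s B : word_val v (normal_word A s B)
  = fpos_ A * rho (fcarets A) ^+ s * (fpos_ B)^-1.
Proof. by rewrite /normal_word !word_valE mulgA. Qed.

Lemma normal_step A s B j B' : fcarets A = fcarets B -> fstep B j B' ->
  exists A' s', fcarets A' = fcarets B' /\
    word_val v (normal_word A s B) = word_val v (normal_word A' s' B').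
Proof.
move=> AB BB'; set N := fleaves A.
have NB : fleaves B = N by rewrite /N !fleavesE AB.
have jN : j < N by rewrite -NB (fstep_lt BB').
have N0 : 0 < N by lia.
(* Leaf i is the one sent to leaf j by the rotation by s, so splitting it in A matches the caret
   added to B. *)
pose i := (j + (N - s %% N)) %% N.
have iN : i < N by rewrite ltn_pmod.
have ij : (i + s) %% N = j.
  rewrite modnDml -modnDmr -addnA subnK; last exact: ltnW (ltn_pmod _ N0).
  by rewrite modnDr modn_small.
have [A' AA'] := fstep_exists iN.
have := @rho_caret (fcarets A) s i; rewrite -fleavesE -/N ij => /(_ iN)[e Ee].
exists A', e; rewrite (fstep_carets AA') (fstep_carets BB') AB; split=> //.
rewrite !normal_valE (fstep_pos AA') (fstep_pos BB') (fstep_carets AA') -AB.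
by rewrite invgM -[in RHS](mulgA (fpos_ A)) -Ee !mulgA mulgK.
Qed.

Lemma normal_reach B E : reach fstep B E -> forall A s, fcarets A = fcarets B ->
  exists A' s', fcarets A' = fcarets E /\
    word_val v (normal_word A s B) = word_val v (normal_word A' s' E).
Proof.
elim=> {B E} [B|B j B' E BB' _ IH] A s AB; first by exists A, s.
have [A' [s' [A'B' ->]]] := normal_step s AB BB'; exact: IH.
Qed.

(** Finite order makes inverses of rotations nonnegative powers, as normal words require. *)
Lemma rhoV n s : (rho n ^+ s)^-1 = rho n ^+ ((2 * n).+1 * s).
Proof.
apply: mulg1_eq; rewrite -expgnDr -[X in X + _]mul1n -mulnDl add1n mulnC expgnA.
by rewrite -expgnA mulnC expgnA (rho_order sat) expg1n.
Qed.

Lemma normal_inv A s B : fcarets A = fcarets B -> exists s',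
  (word_val v (normal_word A s B))^-1 = word_val v (normal_word B s' A).
Proof.
move=> AB; exists ((2 * fcarets A).+1 * s)%N.
by rewrite !normal_valE !invgM invgK rhoV AB mulgA.
Qed.

Lemma normal_mul A s B C t D : fcarets A = fcarets B -> fcarets C = fcarets D ->
  exists E u F, fcarets E = fcarets F /\
    word_val v (normal_word A s B) * word_val v (normal_word C t D)
    = word_val v (normal_word E u F).
Proof.
move=> AB CD; have [E BE CE] := freach_join B C.
have [A' [s' [A'E ->]]] := normal_reach BE s AB.
(* Refinement is driven by the right-hand forest, so C is refined to E in the inverse of the second
   factor. *)
have [t' Et'] := normal_inv t CD.
have [D' [u [D'E Eu]]] := normal_reach CE t' (esym CD).
have [u' Eu'] := normal_inv u D'E; exists A', (s' + u'), D'; split.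
  by rewrite A'E.
have -> : word_val v (normal_word C t D) = word_val v (normal_word E u' D').
  by rewrite -Eu' -Eu -Et' invgK.
by rewrite !normal_valE A'E !mulgA mulgVK expgnDr !mulgA.
Qed.

Lemma normal_mod A s B : fcarets A = fcarets B ->
  word_val v (normal_word A s B)
  = word_val v (normal_word A (s %% fleaves B) B).
Proof.
move=> AB; rewrite !normal_valE {1}(divn_eq s (fleaves B)) expgnDr mulnC expgnA.
by rewrite AB fleavesE (rho_order sat) expg1n mul1g.
Qed.

Lemma normal_gen x : exists A s B, fcarets A = fcarets B /\
  v x = word_val v (normal_word A s B).
Proof.
pose on_right t : forest := (OLeaf, t).
(* For g_k the second forest is a vine, whose positive word is empty, and the first has its
   non-spine caret at leaf k - 1. *)
case: x; [exists (ocaret, OLeaf), 0, (on_right ocaret)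
  | exists (on_right (ONode ocaret OLeaf OLeaf)), 0, (on_right (ONode OLeaf
    OLeaf ocaret))
  | exists (on_right (ONode OLeaf ocaret OLeaf)), 0, (on_right (ONode OLeaf
    OLeaf ocaret))
  | exists root_forest, 1%N, root_forest]; split=> //;
by rewrite normal_valE /= ?expg0 ?expg1 ?word_val_nil ?invg1 ?mulg1 ?mul1g
  word_val_gen.
Qed.

Lemma normal_form w : exists A s B,
  [/\ fcarets A = fcarets B, s < fleaves B
    & word_val v w = word_val v (normal_word A s B)].
Proof.
suff [A [s [B [AB ->]]]] : exists A s B, fcarets A = fcarets B /\
    word_val v w = word_val v (normal_word A s B).
  exists A, (s %% fleaves B), B; split=> //; last exact: normal_mod.
  by rewrite ltn_pmod // fleavesE.
elim: w => [|[x b] w [C [t [D [CD Ew]]]]].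
  by exists root_forest, 0, root_forest.
rewrite -cat1s word_val_cat Ew.
suff [A [s [B [AB ->]]]] : exists A s B, fcarets A = fcarets B /\
    word_val v [:: (x, b)] = word_val v (normal_word A s B).
  exact: normal_mul.
rewrite /word_val big_seq1 -/(word_val _ _) /letter_val /=.
have [A [s [B [AB ->]]]] := normal_gen x; case: b; first by exists A, s, B.
by have [s' ->] := normal_inv s AB; exists B, s', A.
Qed.

End NormalForm.

(** * Partitions of the circle *)

Section Lists.
Variables (S T : Type) (r : S -> T -> Prop).
Implicit Types (L : seq S) (M : seq T).

Lemma Forall2_size L M : List.Forall2 r L M -> size L = size M.
Proof. by elim=> //= x y L' M' _ _ ->. Qed.

Lemma Forall2_catP L1 L2 M1 M2 : size L1 = size M1 ->
  List.Forall2 r (L1 ++ L2) (M1 ++ M2) <->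
  List.Forall2 r L1 M1 /\ List.Forall2 r L2 M2.
Proof.
elim: L1 M1 => [|x L1 IH] [|y M1] //= => [_|[eq12]].
  by split=> [?|[]] //; split.
split=> [H|[H H2]]; inversion_clear H.
  by have [] := (IH M1 eq12).1 H1; split=> //; constructor.
by constructor=> //; apply/(IH M1 eq12).
Qed.

Lemma Forall2_catl L1 L2 M : List.Forall2 r (L1 ++ L2) M -> exists M1 M2,
  [/\ M = M1 ++ M2, size M1 = size L1, List.Forall2 r L1 M1 & List.Forall2 r L2
    M2].
Proof.
move=> H; have sM := Forall2_size H; rewrite size_cat in sM.
have s1 : size (take (size L1) M) = size L1 by rewrite size_takel // -sM
  leq_addr.
exists (take (size L1) M), (drop (size L1) M); rewrite cat_take_drop s1.
by move: H; rewrite -{1}(cat_take_drop (size L1) M) Forall2_catP // => -[].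
Qed.

Lemma Forall2_consl x L M : List.Forall2 r (x :: L) M -> exists y M',
  [/\ M = y :: M', r x y & List.Forall2 r L M'].
Proof. by move=> H; inversion_clear H; exists y, l'. Qed.

Lemma Forall2_nthP d d' L M : List.Forall2 r L M <->
  size L = size M /\ forall i, i < size L -> r (nth d L i) (nth d' M i).
Proof.
split=> [|[]].
  by elim=> //= x y L' M' xy _ [-> IH]; split=> // -[|i] //=; apply: IH.
elim: L M => [|x L IH] [|y M] //= [eqLM] H; constructor; first exact: (H 0).
by apply: IH => // i; apply: (H i.+1).
Qed.

Lemma Forall2_rot s L M : List.Forall2 r L M -> List.Forall2 r (rot s L) (rot s
  M).
Proof.
move=> H; have sLM := Forall2_size H.
have sd : size (drop s L) = size (drop s M) by rewrite !size_drop sLM.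
have st : size (take s L) = size (take s M) by rewrite !size_take sLM.
move: H; rewrite -{1}(cat_take_drop s L) -{1}(cat_take_drop s M) Forall2_catP
  //.
by case=> ? ?; rewrite /rot Forall2_catP.
Qed.

End Lists.

Lemma Forall2_comp S T U (r : S -> T -> Prop) (r' : T -> U -> Prop) r'' L M N :
    (forall x y z, r x y -> r' y z -> r'' x z) ->
  List.Forall2 r L M -> List.Forall2 r' M N -> List.Forall2 r'' L N.
Proof.
move=> comp LM; elim: LM N => [|x y L' M' xy _ IH] N MN; inversion_clear MN.
  by constructor.
by constructor; [apply: comp xy _|apply: IH].
Qed.

Lemma Forall2_flip S T (r : S -> T -> Prop) (r' : T -> S -> Prop) L M :
  (forall x y, r x y -> r' y x) -> List.Forall2 r L M -> List.Forall2 r' M L.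
Proof. by move=> flip; elim=> *; constructor; auto. Qed.

Section Rotations.
Variable T : Type.
Implicit Types M N X Y : seq T.

Lemma nth_rot d M s i : s <= size M -> i < size M ->
  nth d (rot s M) i = nth d M ((i + s) %% size M).
Proof.
move=> sM iM; rewrite /rot nth_cat size_drop nth_drop [s + i]addnC.
case: ltnP => is_; first by rewrite modn_small //; lia.
have -> : i + s = (i - (size M - s)) + size M by lia.
by rewrite modnDr nth_take ?modn_small //; lia.
Qed.

Lemma rot_small M s : 0 < size M -> exists2 s', s' < size M & rot s M = rot s'
  M.
Proof.
move=> M0; have [sM|Ms] := ltnP s (size M); first by exists s.
by exists 0; rewrite // rot0 rot_oversize.
Qed.

Lemma rot_inv M s N : rot s M = N -> exists s', rot s' N = M.
Proof. by move=> <-; exists (size (rot s M) - s); exact: rotK. Qed.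

(** The hypothesis says that the rotation does not cut the block X. The block can then be replaced
    by any Y, for a suitable new rotation. *)
Lemma rot_block M1 X M2 s :
    s <= size M1 \/ size (M1 ++ X) <= s < size (M1 ++ X ++ M2) ->
  exists N1 N2, [/\ rot s (M1 ++ X ++ M2) = N1 ++ X ++ N2,
    size N1 + s = size M1 \/ size N1 + s = size M1 + size (M1 ++ X ++ M2)
  & forall Y, exists s', rot s' (M1 ++ Y ++ M2) = N1 ++ Y ++ N2].
Proof.
case=> [sM1|/andP[Xs s_lt]].
  exists (drop s M1), (M2 ++ take s M1); split=> [|| Y].
  - by rewrite /rot drop_cat take_cat; case: ltngtP sM1 => // [_|->] _;
      rewrite ?subnn ?take0 ?drop0 ?cats0 ?drop_size ?take_size -?catA.
  - by left; rewrite size_drop subnK.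
  - exists s; rewrite /rot drop_cat take_cat; case: ltngtP sM1 => // [_|->] _;
      by rewrite ?subnn ?take0 ?drop0 ?cats0 ?drop_size ?take_size -?catA.
move: Xs s_lt; rewrite !size_cat => Xs s_lt.
pose k := s - (size M1 + size X).
have sM1 Y : size M1 + size Y + k < size M1 + size Y = false by lia.
have rotE Y : rot (size M1 + size Y + k) (M1 ++ Y ++ M2)
    = (drop k M2 ++ M1) ++ Y ++ take k M2.
  rewrite catA -size_cat /rot drop_cat take_cat size_cat sM1 addKn.
  by rewrite -!catA.
exists (drop k M2 ++ M1), (take k M2); split=> [|| Y].
- by rewrite -rotE /k subnKC.
- by right; rewrite size_cat size_drop /k; lia.
- by exists (size M1 + size Y + k).
Qed.

Lemma rot_subst M s N1 y N2 : rot s M = N1 ++ y :: N2 ->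
  exists M1 M2, M = M1 ++ y :: M2 /\
    forall Y, exists s', rot s' (M1 ++ Y ++ M2) = N1 ++ Y ++ N2.
Proof.
move=> /rot_inv[s0]; have [|s' s'_lt ->] := @rot_small (N1 ++ y :: N2) s0.
  by rewrite size_cat addnS.
(* A single entry is never cut, so [rot_block] applies to the inverse rotation. *)
rewrite -cat1s => Es'; have [|M1 [M2 [E _ sub]]] := @rot_block N1 [:: y] N2 s'.
  by move: s'_lt; rewrite !size_cat /=; lia.
exists M1, M2; split=> [|Y]; first by rewrite -Es' E.
by have [k /rot_inv] := sub Y.
Qed.

End Rotations.

Section Intervals.
Local Open Scope ring_scope.
Import Order.TTheory GRing.Theory Num.Theory.
Variable R : realType.

(* The interval [a, b) of a leaf, coloured by the parity of the binary digit
   sum of a; this is the 2-colouring of the vertices of the Thompson graph. *)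
Definition cint := ((R * R) * bool)%type.
Implicit Types (x y z : cint) (f g h : circle_bij R) (L M N : seq cint).

Definition lhalf x : cint := ((x.1.1, (x.1.1 + x.1.2) / 2), x.2).
Definition rhalf x : cint := (((x.1.1 + x.1.2) / 2, x.1.2), ~~ x.2).

Fixpoint cleaves (t : tree) x : seq cint :=
  if t is Node l r then cleaves l (lhalf x) ++ cleaves r (rhalf x) else [:: x].

Fixpoint colors (t : tree) (c : bool) : seq bool :=
  if t is Node l r then colors l c ++ colors r (~~ c) else [:: c].

Lemma cleaves_intervals t x :
  [seq y.1 | y <- cleaves t x] = leaf_intervals t x.1.1 x.1.2.
Proof.
elim: t x => [|l IHl r IHr] x /=; first by rewrite -surjective_pairing.
by rewrite map_cat IHl IHr.
Qed.

Lemma cleaves_colors t x : [seq y.2 | y <- cleaves t x] = colors t x.2.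
Proof. by elim: t x => [|l IHl r IHr] x //=; rewrite map_cat IHl IHr. Qed.

Lemma size_cleaves t x : size (cleaves t x) = nleaves t.
Proof. by elim: t x => [|l IHl r IHr] x //=; rewrite size_cat IHl IHr. Qed.

Definition in_unit x := 0 <= x.1.1 /\ x.1.1 < x.1.2 <= 1.

Definition inside (t : R) x := x.1.1 <= t < x.1.2.

(* The slope equation is stated without division, which makes carries f e x y
   symmetric under inversion of f. *)
Definition carries f (e : bool) x y :=
  [/\ in_unit x, in_unit y, y.2 = x.2 (+) e &
      forall t : circle R, inside (val t) x ->
        (val (f t) - y.1.1) * (x.1.2 - x.1.1)
        = (val t - x.1.1) * (y.1.2 - y.1.1)].

Lemma slopeP (a b c d s t : R) : a < b ->
  s = c + (d - c) / (b - a) * (t - a) <-> (s - c) * (b - a) = (t - a) * (d - c).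
Proof.
move=> ab; have ab0 : b - a != 0 by lra.
split=> [->|E]; first by field.
by apply: (addIr (- c)); apply: (mulIf ab0); rewrite E; field.
Qed.

Definition maps f e := List.Forall2 (carries f e).

Lemma carries_inside f e x y (t : circle R) :
  carries f e x y -> inside (val t) x -> inside (val (f t)) y.
Proof. by case=> -[? ?] [? ?] _ H tx; have := H t tx; rewrite /inside in tx *;
  nra. Qed.

Lemma carries_halves f e x y : carries f e x y ->
  carries f e (lhalf x) (lhalf y) /\ carries f e (rhalf x) (rhalf y).
Proof.
case=> -[? ?] [? ?] c H; split; split.
- by rewrite /in_unit /=; split; lra.
- by rewrite /in_unit /=; split; lra.
- by [].
- move=> t; have := H t; move: (val t) (val (f t)) => {}t s.
  by rewrite /inside /= => Hs tx; have := Hs ltac:(lra); lra.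
- by rewrite /in_unit /=; split; lra.
- by rewrite /in_unit /=; split; lra.
- by rewrite /= c addNb.
- move=> t; have := H t; move: (val t) (val (f t)) => {}t s.
  by rewrite /inside /= => Hs tx; have := Hs ltac:(lra); lra.
Qed.

(** This undoes a common binary caret, as reduction of a triple requires. *)
Lemma carries_join f e x y : in_unit x -> in_unit y ->
  carries f e (lhalf x) (lhalf y) -> carries f e (rhalf x) (rhalf y) ->
  carries f e x y.
Proof.
move=> px py [_ _ c H1] [_ _ _ H2]; split=> // t; have [? ?] := px.
move: (H1 t) (H2 t); move: (val t) (val (f t)) => {}t s.
rewrite /inside /= => {}H1 {}H2 tx.
by case: (ltP t ((x.1.1 + x.1.2) / 2)) => tm;
  [have := H1 ltac:(lra) | have := H2 ltac:(lra)]; lra.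
Qed.

Lemma maps_cleaves f e u x y : carries f e x y ->
  maps f e (cleaves u x) (cleaves u y).
Proof.
elim: u x y => [|l IHl r IHr] x y xy /=; first by constructor.
have [xyl xyr] := carries_halves xy.
apply/Forall2_catP; first by rewrite !size_cleaves.
by split; [apply: IHl|apply: IHr].
Qed.

Lemma carries_comp f g e e' x y z :
  carries f e x y -> carries g e' y z -> carries (f * g)%g (e (+) e') x z.
Proof.
move=> fxy gyz; have ins := @carries_inside f e x y _ fxy.
case: fxy gyz => px py cy Hf [_ pz cz Hg].
split=> //; first by rewrite cz cy addbA.
move=> t tx; have := Hg _ (ins t tx); have := Hf t tx.
case: px py => ? ? [? ?] /=; set s := val (f t);
  set r := val (g (f t)) => E1 E2.
have : (r - z.1.1) * (x.1.2 - x.1.1) * (y.1.2 - y.1.1)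
    = (val t - x.1.1) * (z.1.2 - z.1.1) * (y.1.2 - y.1.1).
  by rewrite [LHS]mulrAC E2 [LHS]mulrAC E1 [LHS]mulrAC.
by apply: mulIf; lra.
Qed.

Lemma carries_inv f e x y : carries f e x y -> carries (f^-1)%g e y x.
Proof.
case=> px py c H; split=> //; first by rewrite c addbK.
move=> s sy; have := valP s; rewrite /inside in sy => s01.
case: (px) (py) => ? ? [? ?].
(* The point t is the affine preimage of s; once f sends it to s, it must be the value of the
   inverse. *)
have [t tE] : exists t,
    (t - x.1.1) * (y.1.2 - y.1.1) = (val s - y.1.1) * (x.1.2 - x.1.1).
  exists (x.1.1 + (val s - y.1.1) * (x.1.2 - x.1.1) / (y.1.2 - y.1.1)).
  by rewrite addrAC subrr add0r mulfVK //; lra.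
have tx : x.1.1 <= t < x.1.2 by nra.
have t01 : 0 <= t < 1 by lra.
pose t' : circle R := exist _ t t01; have vt' : val t' = t by [].
have := H t'; rewrite vt' => /(_ tx); rewrite tE => Es.
have {}Es : val (f t') = val s.
  apply: (addIr (- y.1.1)); apply: mulIf Es; lra.
have -> : (f^-1)%g s = t' by rewrite -(val_inj Es); apply: cfunK.
by rewrite vt' tE.
Qed.

Lemma maps_comp f g e e' L M N :
  maps f e L M -> maps g e' M N -> maps (f * g)%g (e (+) e') L N.
Proof. by apply: Forall2_comp; apply: carries_comp. Qed.

Lemma maps_inv f e L M : maps f e L M -> maps (f^-1)%g e M L.
Proof. by apply: Forall2_flip; apply: carries_inv. Qed.

Lemma carries_uniq f g e e' x y (t : circle R) :
  carries f e x y -> carries g e' x y -> inside (val t) x -> f t = g t.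
Proof.
move=> [[_ ?] _ _ Hf] [_ _ _ Hg] tx; apply: val_inj.
have := Hf t tx; rewrite -(Hg t tx) => E.
by apply: (addIr (- y.1.1)); apply: mulIf E; lra.
Qed.

Lemma carries_id x : in_unit x -> carries 1%g false x x.
Proof. by move=> px; split=> //; rewrite addbF. Qed.

Definition whole : cint := ((0, 1), false).

Definition leaves t := cleaves t whole.

Lemma in_unit_whole : in_unit whole.
Proof. by rewrite /in_unit /=; split; lra. Qed.

Lemma maps_id t : maps 1%g false (leaves t) (leaves t).
Proof. exact: maps_cleaves (carries_id in_unit_whole). Qed.

Lemma cleaves_cover d u x (t : R) : inside t x ->
  exists2 i, (i < nleaves u)%N & inside t (nth d (cleaves u x) i).
Proof.
elim: u x => [|l IHl r IHr] x tx /=; first by exists 0%N.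
have [tm|tm] := ltP t ((x.1.1 + x.1.2) / 2).
  have [|i il ti] := IHl (lhalf x); first by rewrite /inside /= in tx *; lra.
  by exists i; rewrite ?nth_cat ?size_cleaves ?il // ltn_addr.
have [|i il ti] := IHr (rhalf x); first by rewrite /inside /= in tx *; lra.
exists (nleaves l + i)%N; rewrite ?ltn_add2l //.
by rewrite nth_cat size_cleaves ltnNge leq_addr addKn.
Qed.

Lemma maps_uniq f g e e' u M :
  maps f e (leaves u) M -> maps g e' (leaves u) M -> f = g.
Proof.
move=> /(Forall2_nthP _ whole whole)[_ Hf] /(Forall2_nthP _ whole whole)[_ Hg].
apply: circle_bijP => t;
  have [|i iu ti] := @cleaves_cover whole u whole (val t).
  exact: valP t.
by apply: carries_uniq (Hf i _) (Hg i _) ti; rewrite size_cleaves.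
Qed.

(** Comparison through the target serves when the source list is not displayed as the leaves of a
    tree. *)
Lemma maps_uniqr f g e e' L u s :
  maps f e L (rot s (leaves u)) -> maps g e' L (rot s (leaves u)) -> f = g.
Proof.
have [s' Es] := rot_inv (erefl (rot s (leaves u))) => Hf Hg.
have {}Hf := maps_inv (Forall2_rot s' Hf);
  have {}Hg := maps_inv (Forall2_rot s' Hg).
by rewrite Es in Hf Hg; apply: (invg_inj (maps_uniq Hf Hg)).
Qed.

End Intervals.

Inductive sub (u : tree) : tree -> nat -> tree -> Prop :=
| SubLeaf : sub u Leaf 0 u
| SubL l r i l' : sub u l i l' -> sub u (Node l r) i (Node l' r)
| SubR l r i r' : sub u r i r' -> sub u (Node l r) (nleaves l + i) (Node l r').

Lemma sub_exists u t i : i < nleaves t -> exists t', sub u t i t'.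
Proof.
elim: t i => [|l IHl r IHr] i /= it.
  by case: i it => // _; exists u; apply: SubLeaf.
have [il|li] := ltnP i (nleaves l).
  by have [l' ll'] := IHl i il; exists (Node l' r); apply: SubL.
have [|r' rr'] := IHr (i - nleaves l); first by lia.
by exists (Node l r'); rewrite -(subnKC li); apply: SubR.
Qed.

Lemma nleaves_gt0 t : 0 < nleaves t.
Proof. by elim: t => //= l l0 r r0; rewrite addn_gt0 l0. Qed.

Definition caret := Node Leaf Leaf.

(* A ternary caret splits an interval into its left half and the two halves of
   its right half; this keeps the colours of consecutive leaves alternating. *)
Fixpoint emb (t : otree) : tree :=
  if t is ONode a b c then Node (emb a) (Node (emb b) (emb c)) else Leaf.

Definition femb (A : forest) : tree := Node (emb A.1) (emb A.2).

Lemma nleaves_emb t : nleaves (emb t) = oleaves t.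
Proof. by elim: t => //= a -> b -> c ->; rewrite /oleaves /=; lia. Qed.

Lemma nleaves_femb A : nleaves (femb A) = fleaves A.
Proof. by rewrite /= !nleaves_emb. Qed.

(* Locked, since rewriting with catA would otherwise unfold cleaves tri x. *)
Definition tri := locked (emb ocaret).

Lemma triE : tri = emb ocaret.
Proof. by rewrite /tri -lock. Qed.

Lemma nleaves_tri : nleaves tri = 3.
Proof. by rewrite triE. Qed.

Lemma ostep_sub t i t' : ostep t i t' -> sub tri (emb t) i (emb t').
Proof.
elim=> {t i t'} [|a b c i a' _ IH|a b c i b' _ IH|a b c i c' _ IH] /=.
- by rewrite triE; apply: (SubLeaf (emb ocaret)).
- exact: SubL.
- by rewrite -nleaves_emb; apply/SubR/SubL.
- by rewrite -addnA -!nleaves_emb; apply/SubR/SubR.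
Qed.

Lemma fstep_sub A i A' : fstep A i A' -> sub tri (femb A) i (femb A').
Proof.
case=> l {}i l' r /ostep_sub H; first exact: SubL.
by rewrite -nleaves_emb; apply: SubR.
Qed.

Fixpoint ovine n : otree :=
  if n is n'.+1 then ONode OLeaf OLeaf (ovine n') else OLeaf.

Definition vine n : forest := (OLeaf, ovine n).

Lemma carets_ovine n : carets (ovine n) = n.
Proof. by elim: n => //= n ->. Qed.

Lemma fcarets_vine n : fcarets (vine n) = n.
Proof. exact: carets_ovine. Qed.

Lemma vine_step n : fstep (vine n) (2 * n).+1 (vine n.+1).
Proof.
rewrite -add1n; apply: (@FStepR OLeaf).
elim: n => [|n IHn]; first exact: OStepLeaf.
by rewrite mulnS; apply: (@OStepR OLeaf OLeaf).
Qed.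

Lemma cat_eq_split T (L1 L2 K M : seq T) x : L1 ++ x :: L2 = K ++ M ->
  size L1 < size K -> exists P, K = L1 ++ x :: P /\ L2 = P ++ M.
Proof.
elim: L1 K => [|y L1 IH] [|z K] //= [<-]; first by move=> ->; exists K.
by move=> /IH H /H[P [-> ->]]; exists P.
Qed.

Lemma cat_cons_inj T (L1 L2 M1 M2 : seq T) x y :
  L1 ++ x :: L2 = M1 ++ y :: M2 -> size L1 = size M1 ->
  [/\ L1 = M1, x = y & L2 = M2].
Proof.
elim: L1 M1 => [|z L1 IH] [|w M1] //= [-> E]; first by [].
by case=> /(IH _ E)[-> -> ->].
Qed.

(** * Shifts and rotations of vines *)

Section Geometry.
Variable R : realType.
Implicit Types (f g h : circle_bij R) (L M N : seq (cint R)) (x y z : cint R).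
Local Notation leaves := (leaves R).

Lemma cleaves_sub u t i t' x : sub u t i t' -> exists L1 y L2,
  [/\ cleaves t x = L1 ++ y :: L2, cleaves t' x = L1 ++ cleaves u y ++ L2
    & size L1 = i].
Proof.
move=> tt'; elim: tt' x => {t i t'} [|l r i l' _ IH|l r i r' _ IH] x /=.
- by exists [::], x, [::]; rewrite cats0.
- have [L1 [y [L2 [-> -> <-]]]] := IH (lhalf x).
  by exists L1, y, (L2 ++ cleaves r (rhalf x)); rewrite -!catA.
- have [L1 [y [L2 [-> -> <-]]]] := IH (rhalf x).
  exists (cleaves l (lhalf x) ++ L1), y, L2.
  by rewrite -!catA size_cat size_cleaves.
Qed.

Lemma leaves_sub u t L1 y L2 : leaves t = L1 ++ y :: L2 ->
  exists t', sub u t (size L1) t' /\ leaves t' = L1 ++ cleaves u y ++ L2.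
Proof.
move=> Et; have [|t' tt'] := @sub_exists u t (size L1).
  have := congr1 size Et; rewrite size_cleaves => ->.
  by rewrite size_cat addnS ltnS leq_addr.
exists t'; split=> //; have [K1 [z [K2 []]]] := cleaves_sub (whole R) tt'.
rewrite -!/(leaves _) Et => /eqP E -> sK.
by move: E; rewrite eqseq_cat // eqseq_cons => /and3P[/eqP<- /eqP<- /eqP<-].
Qed.

Lemma maps_consr f e L M x L2 : maps f e (L ++ x :: L2) M -> exists M1 y M2,
  [/\ M = M1 ++ y :: M2, size M1 = size L, maps f e L M1, carries f e x y
    & maps f e L2 M2].
Proof.
move=> H; have [M1 [M2 [-> sM LM1 H2]]] := Forall2_catl H.
by have [y [M3 [-> xy LM3]]] := Forall2_consl H2; exists M1, y, M3.
Qed.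

Lemma maps_catP f e L1 L2 M1 M2 : size L1 = size M1 ->
  maps f e (L1 ++ L2) (M1 ++ M2) <-> maps f e L1 M1 /\ maps f e L2 M2.
Proof. exact: Forall2_catP. Qed.

Lemma maps_cat f e L1 L2 M1 M2 : maps f e L1 M1 -> maps f e L2 M2 ->
  maps f e (L1 ++ L2) (M1 ++ M2).
Proof. by move=> H; rewrite maps_catP ?(Forall2_size H). Qed.

(* The elements g_(k+1) and c_(2n) of the paper act on vines in this way. *)
Definition vine_shift k f := forall m L1 x L2, k < (2 * m).+1 ->
  leaves (femb (vine m)) = L1 ++ x :: L2 -> size L1 = k ->
  maps f false (L1 ++ cleaves tri x ++ L2) (leaves (femb (vine m.+1))).

Definition vine_rot n f :=
  maps f true (leaves (femb (vine n))) (rot 1 (leaves (femb (vine n)))).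

Local Notation vl m := (leaves (femb (vine m))).

Lemma size_vl m : size (vl m) = (2 * m).+2.
Proof. by rewrite size_cleaves nleaves_femb fleavesE fcarets_vine. Qed.

Lemma vl_last m : exists L z,
  [/\ vl m = L ++ [:: z], vl m.+1 = L ++ cleaves tri z & size L = (2 * m).+1].
Proof.
have [L [z [L2 [E1 E2 sL]]]] := cleaves_sub (whole R) (fstep_sub (vine_step m)).
have := congr1 size E1; rewrite -/(leaves _) size_vl size_cat sL /= => s2.
have L20 : L2 = [::] by apply: size0nil; lia.
by exists L, z; rewrite /leaves E1 E2 L20 cats0.
Qed.

Lemma vl_nth m k : k < (2 * m).+2 -> exists L1 x L2,
  vl m = L1 ++ x :: L2 /\ size L1 = k.
Proof.
move=> km; exists (take k (vl m)), (nth (whole R) (vl m) k), (drop k.+1 (vl m)).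
by rewrite -drop_nth ?cat_take_drop ?size_vl // size_takel ?size_vl // ltnW.
Qed.

Lemma vl_inner m L1 x L2 : size L1 <= 2 * m -> vl m.+1 = L1 ++ x :: L2 ->
  exists L z, [/\ vl m = L1 ++ x :: L ++ [:: z], L2 = L ++ cleaves tri z
    & size L1 + size L = 2 * m].
Proof.
move=> s1 E; have [K [z [E1 E2 sK]]] := vl_last m.
have [|P [EK ->]] := cat_eq_split (etrans (esym E) E2); first by rewrite sK.
exists P, z; split=> //; first by rewrite E1 EK -catA.
by move: sK; rewrite EK size_cat /=; lia.
Qed.

(** Leaf k is not the last one, so f carries the last leaf of the vine to the last leaf of the next
    vine; splitting both gives the assertion for the longer vine. *)
Lemma vine_shift_up k f m : k < (2 * m).+1 ->
    (forall L1 x L2, vl m = L1 ++ x :: L2 -> size L1 = k ->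
      maps f false (L1 ++ cleaves tri x ++ L2) (vl m.+1)) ->
  forall L1 x L2, vl m.+1 = L1 ++ x :: L2 -> size L1 = k ->
    maps f false (L1 ++ cleaves tri x ++ L2) (vl m.+2).
Proof.
move=> km H L1 x L2 E s1; have [|L [z [E1 -> sL]]] := vl_inner _ E;
  first by lia.
have := H _ _ _ E1 s1; rewrite !catA => /maps_consr[M1 [y [M2 [EM sM1 H1 zy
  H2]]]].
have [K [w [EK -> sK]]] := vl_last m.+1.
have M20 : M2 = [::] by inversion H2.
move: EM; rewrite EK M20 => /eqP; rewrite eqseq_cat; last first.
  by rewrite sM1 sK !size_cat size_cleaves nleaves_tri; lia.
case/andP=> /eqP -> /eqP[->]; apply: maps_cat => //; exact: maps_cleaves.
Qed.

(** The bounds single out the shortest vine in which leaf k is not the last; checking that vine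
    suffices. *)
Lemma vine_shiftP k f m : (2 * m).-1 <= k < (2 * m).+1 ->
    (forall L1 x L2, vl m = L1 ++ x :: L2 -> size L1 = k ->
      maps f false (L1 ++ cleaves tri x ++ L2) (vl m.+1)) ->
  vine_shift k f.
Proof.
move=> /andP[mk km] H; elim=> [|p IHp] L1 x L2 kp.
  by move: H; have -> : m = 0 by [lia]; apply.
have [kp'|pk] := ltnP k (2 * p).+1.
  by apply: (vine_shift_up kp') => *; apply: IHp.
by move: H; have -> : m = p.+1 by [lia]; apply.
Qed.

Lemma vine_shift_uniq k f g : vine_shift k f -> vine_shift k g -> f = g.
Proof.
move=> Hf Hg; have [|L1 [x [L2 [E s1]]]] := @vl_nth k k; first by lia.
have kk : k < (2 * k).+1 by lia.
have {}Hf := Hf k L1 x L2 kk E s1; have {}Hg := Hg k L1 x L2 kk E s1.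
by rewrite -[vl _]rot0 in Hf Hg; apply: maps_uniqr Hf Hg.
Qed.

Lemma maps_subst f e L1 x L2 M : maps f e (L1 ++ x :: L2) M ->
  exists M1 y M2, [/\ M = M1 ++ y :: M2, size M1 = size L1 &
    maps f e (L1 ++ cleaves tri x ++ L2) (M1 ++ cleaves tri y ++ M2)].
Proof.
move=> /maps_consr[M1 [y [M2 [-> sM1 H1 xy H2]]]].
exists M1, y, M2; split=> //.
by apply: maps_cat H1 (maps_cat _ H2); apply: maps_cleaves.
Qed.

Lemma vine_shift_conj k n f g : k < n -> vine_shift k f -> vine_shift n g ->
  vine_shift n.+2 (g ^ f)%g.
Proof.
move=> kn Hf Hg m L1 x L2 nm E s1.
case: m => [|m] in nm E *; first by lia.
have [|K [q [K3 [EK sK]]]] := @vl_nth m n; first by lia.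
have [K1 [p [K2 [EK1 sK1]]]] : exists K1 p K2, K = K1 ++ p :: K2 /\ size K1 = k.
  exists (take k K), (nth q K k), (drop k.+1 K).
  by rewrite -drop_nth ?cat_take_drop ?size_takel // sK // ltnW.
(* Splitting leaf k moves the later leaf n to position n + 2, so f turns the vine split at both k
   and n into the next vine split at n + 2. *)
have Hf1 : maps f false (K1 ++ cleaves tri p ++ K2 ++ cleaves tri q ++ K3)
    (L1 ++ cleaves tri x ++ L2).
  have := Hf m K1 p (K2 ++ q :: K3) ltac:(lia); rewrite EK EK1 -catA.
  move=> /(_ erefl sK1); rewrite catA catA E => /maps_subst.
  case=> M1 [y [M2 [EM sM1]]].
  have [|-> -> ->] := cat_cons_inj EM; last by rewrite -!catA.
  by rewrite sM1 s1 -sK EK1 !size_cat size_cleaves nleaves_tri /=; lia.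
(* With the caret at k kept throughout, g absorbs the caret at n; a second application of f then
   absorbs the one at k. *)
have := Hg m K q K3 ltac:(lia) EK sK; rewrite EK1 -catA => /maps_subst.
case=> J1 [r [J2 [EJ sJ1 Hg1]]].
have := Hf m.+1 J1 r J2 ltac:(lia) EJ; rewrite sJ1 => /(_ sK1) Hf2.
have := maps_comp (maps_inv Hf1) (maps_comp Hg1 Hf2); exact.
Qed.

(** The inverse of g goes back to the shorter vine with leaf 2n split, and f rotates this leaf to
    the last one, whose splitting gives the longer vine again. *)
Lemma vine_rotS n f g : vine_rot n f -> vine_shift (2 * n) g ->
  vine_rot n.+1 (g^-1 * f)%g.
Proof.
move=> Hf Hg; have [L [z [E1 E2 sL]]] := vl_last n.
case: L => [|h T1] // in E1 E2 sL *; case: sL => sT1.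
have [|K [x [K2 [EK sK]]]] := @vl_nth n (2 * n); first by lia.
have [y EK2] : exists y, K2 = [:: y].
  have := congr1 size EK; rewrite size_vl size_cat sK /=.
  by case: K2 {EK} => [|y [|? ?]] /= ?; try lia; exists y.
rewrite {}EK2 in EK; have Hg1 := Hg n K x [:: y] ltac:(lia) EK sK.
have : maps f true (K ++ x :: [:: y]) (T1 ++ z :: [:: h]).
  by have := Hf; rewrite /vine_rot {1}EK E1 cat_cons rot1_cons -cats1 -catA.
case/maps_subst=> M1 [z' [M2 [EM sM1 Hf1]]].
have [|E3 E4 E5] := cat_cons_inj EM; first by rewrite sM1 sK.
rewrite -E3 -E4 -E5 in Hf1;
  rewrite /vine_rot {2}E2 cat_cons rot1_cons -cats1 -catA.
have := maps_comp (maps_inv Hg1) Hf1; exact.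
Qed.

Lemma vine_rotX n f s : vine_rot n f -> s <= (2 * n).+2 ->
  maps (f ^+ s)%g (odd s) (vl n) (rot s (vl n)).
Proof.
move=> Hf; elim: s => [|s IHs] sn; first by rewrite rot0; apply: maps_id.
rewrite rotS ?size_vl // rot_rot expgSr -addn1 oddD.
by apply: maps_comp (IHs (ltnW sn)) _; rewrite -rot_rot rot_rot;
  apply: Forall2_rot.
Qed.

(** Split leaf k of the vine: rotating first and absorbing the caret at leaf k + 1 has the same
    effect as absorbing it at leaf k and then rotating. *)
Lemma vine_rot_shift n k f g h f' : k.+1 < (2 * n).+1 ->
    vine_rot n f -> vine_rot n.+1 f' -> vine_shift k.+1 g -> vine_shift k h ->
  (f * g = h * f')%g.
Proof.
move=> kn Hf Hf' Hg Hh.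
have [|L1 [x [L2 [E s1]]]] := @vl_nth n k; first by lia.
have [|K [y [K2 [EK sK]]]] := @vl_nth n k.+1; first by lia.
case: K => [|q M1] // in EK sK *; case: sK => sM1.
have : maps f true (L1 ++ x :: L2) (M1 ++ y :: (K2 ++ [:: q])).
  by have := Hf; rewrite /vine_rot {1}E EK cat_cons rot1_cons -cats1 -catA.
case/maps_subst=> M [y' [M2 [EM sM Hf1]]].
have [|E3 E4 E5] := cat_cons_inj EM; first by rewrite sM s1.
rewrite -E3 -E4 -E5 in Hf1.
have := Forall2_rot 1 (Hg n (q :: M1) y K2 kn EK (congr1 succn sM1)).
rewrite cat_cons rot1_cons -cats1 -!catA => Hg1.
have := maps_comp (Hh n L1 x L2 ltac:(lia) E s1) Hf'.
by apply: maps_uniqr (maps_comp Hf1 Hg1).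
Qed.

(** Split the last leaf, which yields the next vine. The rotation f brings this caret to leaf 0,
    where g absorbs it, and its three leaves amount to a rotation by 3. *)
Lemma vine_rot_shift0 n f g f' :
  vine_rot n f -> vine_rot n.+1 f' -> vine_shift 0 g -> (f * g = f' ^+ 3)%g.
Proof.
move=> Hf Hf' Hg; have [L [z [E1 E2 sL]]] := vl_last n.
have [|L1 [q [M [EM /size0nil s0]]]] := @vl_nth n 0; first by lia.
rewrite s0 cat0s in EM.
have : maps f true (L ++ z :: [::]) (M ++ q :: [::]).
  by have := Hf; rewrite /vine_rot {1}E1 EM rot1_cons -cats1.
case/maps_subst=> M' [q' [M2 [EM' sM' Hf1]]].
have [|E3 E4 E5] := cat_cons_inj EM'.
  by have := congr1 size E1; rewrite EM size_cat /= addn1 sM' => -[].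
rewrite -E3 -E4 -E5 !cats0 -E2 in Hf1.
have := Forall2_rot (size (cleaves tri q)) (Hg n [::] q M isT EM erefl).
rewrite cat0s rot_size_cat size_cleaves nleaves_tri => Hg1.
have := @vine_rotX n.+1 f' 3 Hf' ltac:(lia).
by apply: maps_uniqr (maps_comp Hf1 Hg1).
Qed.

Lemma vine_rot0_involutive f : vine_rot 0 f -> (f ^+ 2 = 1)%g.
Proof.
move=> Hf; have := @vine_rotX 0 f 2 Hf isT; rewrite rot_oversize ?size_vl //.
by move/maps_uniq; apply; apply: maps_id.
Qed.

End Geometry.

(** * The generators *)

Section Generators.
Local Open Scope ring_scope.
Import Order.TTheory GRing.Theory Num.Theory.
Variable R : realType.
Implicit Types (f : circle_bij R) (F : R -> R) (a b : R).

Ltac affine_cases :=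
  repeat match goal with |- context [if ?b then _ else _] =>
    lazymatch b with
    | context [if _ then _ else _] => fail
    | Order.le ?x ?y => case: (leP x y) => ?; try (exfalso; lra)
    | Order.lt ?x ?y => case: (ltP x y) => ?; try (exfalso; lra)
    end
  end.

Lemma carries_real f F e x y :
    (forall t, val (f t) = F (val t)) -> in_unit x -> in_unit y -> y.2 = x.2
      (+) e ->
    (forall t : R, x.1.1 <= t < x.1.2 ->
      (F t - y.1.1) * (x.1.2 - x.1.1) = (t - x.1.1) * (y.1.2 - y.1.1)) ->
  carries f e x y.
Proof. by move=> fF px py c HF; split=> // t tx; rewrite fF; apply: HF. Qed.

Lemma vine_shift_g1 : vine_shift 0 (x_ R 0 * x_ R 1)%g.
Proof.
apply: (@vine_shiftP _ _ _ 0) => // -[|? ?] //= x L2 [<- <-] _; rewrite triE /=.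
repeat first [exact: List.Forall2_nil | apply: List.Forall2_cons].
all: apply: (@carries_real _ (fun t => x_fun 1 (x_fun 0 t))) => //;
  rewrite /in_unit /=; try (split; lra); move=> t tx; affine_cases; lra.
Qed.

Lemma vine_shift_g2 : vine_shift 1 (x_ R 1 * x_ R 2)%g.
Proof.
apply: (@vine_shiftP _ _ _ 1) => // -[|? [|? ?]] //= x L2 [<- <- <-] _;
  rewrite triE /=.
repeat first [exact: List.Forall2_nil | apply: List.Forall2_cons].
all: apply: (@carries_real _ (fun t => x_fun 2 (x_fun 1 t))) => //;
  rewrite /in_unit /=; try (split; lra); move=> t tx; affine_cases; lra.
Qed.

Lemma vine_shift_g3 : vine_shift 2 (x_ R 2 * x_ R 3)%g.
Proof.
apply: (@vine_shiftP _ _ _ 1) => // -[|? [|? [|? ?]]] //= x L2 [<- <- <- <-] _;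
  rewrite triE /=.
repeat first [exact: List.Forall2_nil | apply: List.Forall2_cons].
all: apply: (@carries_real _ (fun t => x_fun 3 (x_fun 2 t))) => //;
  rewrite /in_unit /=; try (split; lra); move=> t tx; affine_cases; lra.
Qed.

Lemma vine_rot_c0 : vine_rot 0 (f_half R).
Proof.
rewrite /vine_rot /=; repeat first [exact: List.Forall2_nil | apply:
  List.Forall2_cons].
all: apply: (@carries_real _ (@half_fun R)) => //;
  rewrite /in_unit /half_fun /=;
  try (split; lra); move=> t tx; affine_cases; lra.
Qed.

End Generators.

(** * The relations and normal words on the circle *)

Section Realization.
Variable R : realType.
Implicit Types (A B : forest) (f h : circle_bij R).

Local Notation val_ w := (word_val (vgen_val R) w).

Lemma vine_shift_gam k : vine_shift k (val_ (g_ k.+1)).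
Proof.
have [n] := ubnP k; elim: n k => // n IHn k kn.
case: k kn => [|[|[|k]]] kn.
- by rewrite word_val_gen; apply: vine_shift_g1.
- by rewrite word_val_gen; apply: vine_shift_g2.
- by rewrite word_val_gen; apply: vine_shift_g3.
rewrite gam4; apply: (@vine_shift_conj _ k k.+1) => //; apply: IHn; lia.
Qed.

Lemma vine_rot_rho n : vine_rot n (val_ (c_ n)).
Proof.
elim: n => [|n IHn]; first by rewrite word_val_gen; apply: vine_rot_c0.
rewrite (_ : c_ n.+1 = winv (g_ (2 * n).+1) ++ c_ n) // word_val_cat
  word_val_inv.
exact: vine_rotS IHn (@vine_shift_gam _).
Qed.

Lemma vgen_satisfies : satisfies (vgen_val R) vecT_rels.
Proof.
have E1 (a b : circle_bij R) : (a^-1 * b * a = b ^ a)%g.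
  by rewrite conjgE mulgA.
have E2 (a b : circle_bij R) : (a ^- 2 * b * a ^+ 2 = (b ^ a) ^ a)%g.
  by rewrite E1 -conjgM.
have E3 (a b : circle_bij R) : (a ^- 3 * b * a ^+ 3 = ((b ^ a) ^ a) ^ a)%g.
  by rewrite E1 -!conjgM.
have E4 (a b c : circle_bij R) : (c^-1 * a^-1 * b * a * c = (b ^ a) ^ c)%g.
  by rewrite -E1 -E1 !mulgA.
have E5 (a b c : circle_bij R) :
    (c^-1 * a ^- 2 * b * a ^+ 2 * c = ((b ^ a) ^ a) ^ c)%g.
  by rewrite -E2 -E1 !mulgA.
have S1 := @vine_shift_g1 R; have S2 := @vine_shift_g2 R;
  have S3 := @vine_shift_g3 R.
have Hconj k n f g : vine_shift k f -> vine_shift n g -> k < n ->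
    vine_shift n.+2 (g ^ f)%g.
  by move=> Hf Hg kn; apply: vine_shift_conj kn Hf Hg.
have C := vine_rot_rho; have S := @vine_shift_gam.
suff relP i : i < 12 -> val_ (nth ([::], [::]) vecT_rels i).1
    = val_ (nth ([::], [::]) vecT_rels i).2.
  by move=> u w /(nthP ([::], [::]))[i i12 Ei]; have := relP i i12; rewrite Ei.
case: i => [|[|[|[|[|[|[|[|[|[|[|[|i]]]]]]]]]]]] // _.
(* In the six conjugation relations both sides shift the vine at the same leaf, each conjugation
   raising its number by 2. *)
- rewrite !word_valE !E1; apply: (@vine_shift_uniq _ 4);
    by repeat first [exact: S1 | exact: S2 | exact: S3 | refine (Hconj _ _ _ _
      _ _ _)].
- rewrite !word_valE E3 E5; apply: (@vine_shift_uniq _ 7);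
    by repeat first [exact: S1 | exact: S2 | exact: S3 | refine (Hconj _ _ _ _
      _ _ _)].
- rewrite !word_valE E2 E4; apply: (@vine_shift_uniq _ 6);
    by repeat first [exact: S1 | exact: S2 | exact: S3 | refine (Hconj _ _ _ _
      _ _ _)].
- rewrite !word_valE E2 E4; apply: (@vine_shift_uniq _ 6);
    by repeat first [exact: S1 | exact: S2 | exact: S3 | refine (Hconj _ _ _ _
      _ _ _)].
- rewrite !word_valE E2 E4; apply: (@vine_shift_uniq _ 5);
    by repeat first [exact: S1 | exact: S2 | exact: S3 | refine (Hconj _ _ _ _
      _ _ _)].
- rewrite !word_valE E2 E4; apply: (@vine_shift_uniq _ 5);
    by repeat first [exact: S1 | exact: S2 | exact: S3 | refine (Hconj _ _ _ _
      _ _ _)].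
- rewrite (word_val_cat _ (c_ 1)) (word_val_cat _ (wgen G1)).
  exact: vine_rot_shift (C 1%N) (C 2%N) (S 1%N) (S 0%N).
- rewrite (word_val_cat _ (c_ 1)) (word_val_cat _ (wgen G2)).
  exact: vine_rot_shift (C 1%N) (C 2%N) (S 2%N) (S 1%N).
- rewrite (word_val_cat _ (c_ 2)) (word_val_cat _ (wgen G3)).
  exact: vine_rot_shift (C 2%N) (C 3%N) (S 3%N) (S 2%N).
- rewrite (word_val_cat _ (wgen C0)) (word_val_exp _ (c_ 1)).
  exact: vine_rot_shift0 (C 0) (C 1%N) (S 0).
- rewrite (word_val_cat _ (c_ 1)) (word_val_exp _ (c_ 2)).
  exact: vine_rot_shift0 (C 1%N) (C 2%N) (S 0).
- rewrite word_val_exp word_val_nil; exact: vine_rot0_involutive (C 0).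
Qed.

Local Notation sat := vgen_satisfies.

(** Grow A from the two roots: each new caret is carried to the vine of the same size and absorbed
    there by its factor. *)
Lemma maps_fpos A : maps (val_ (fpos A)) false
  (leaves R (femb A)) (leaves R (femb (vine (fcarets A)))).
Proof.
pose P B := maps (val_ (fpos B)) false
  (leaves R (femb B)) (leaves R (femb (vine (fcarets B)))).
suff H B E : reach fstep B E -> P B -> P E.
  apply: H (freach_roots A) _; rewrite /P word_val_nil; exact: maps_id.
elim=> {B E} // B i B' E BB' _ IH HB; apply: IH.
rewrite /P (fstep_pos sat BB') (fstep_carets BB') /caret_val.
have [L1 [x [L2 [E1 E2 sL1]]]] := cleaves_sub (whole R) (fstep_sub BB').
have := HB; rewrite /P {1}/leaves E1 => /maps_subst[M1 [y [M2 [EM sM1 HB']]]].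
rewrite {1}/leaves E2; case: ltnP => ni.
  apply: (maps_comp HB'); apply: vine_shift_gam => //.
  by rewrite sM1.
(* At the last leaf the split vine already is the next vine, in agreement with the trivial
   factor. *)
have [K [z [EK -> sK]]] := vl_last R (fcarets B).
have iB := fstep_lt BB'; rewrite fleavesE in iB.
have [|-> -> M20] := cat_cons_inj (etrans (esym EK) EM);
  first by rewrite sK sM1; lia.
by rewrite mulg1; move: HB'; rewrite -M20 cats0.
Qed.

Lemma normal_maps A s B : fcarets A = fcarets B -> s <= fleaves B ->
  maps (val_ (normal_word A s B)) (odd s)
    (leaves R (femb A)) (rot s (leaves R (femb B))).
Proof.
move=> AB sB; rewrite normal_valE AB.
have HA := maps_fpos A; rewrite AB in HA.
have HB := Forall2_rot s (maps_inv (maps_fpos B)).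
have HC := @vine_rotX _ _ _ s (vine_rot_rho (fcarets B)).
rewrite fleavesE in sB; have := maps_comp (maps_comp HA (HC sB)) HB.
by rewrite addbF addFb.
Qed.

End Realization.

(** * Recovering the forests from the identity map *)

Section Faithful.
Local Open Scope ring_scope.
Import Order.TTheory GRing.Theory Num.Theory.
Variable R : realType.
Implicit Types (t u l r : tree) (a b : R).

Lemma leaf_intervals_cons t a b : a < b -> exists c T,
  leaf_intervals t a b = (a, c) :: T /\ all (fun I => a < I.1 < b) T.
Proof.
elim: t a b => [|l IHl r IHr] a b ab /=; first by exists b, [::].
have [|c [T [-> HT]]] := IHl a ((a + b) / 2); first by lra.
have [|d [U [-> HU]]] := IHr ((a + b) / 2) b; first by lra.
exists c, (T ++ ((a + b) / 2, d) :: U); split=> //.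
rewrite all_cat /=; apply/and3P; split; last 1 first.
- by apply: sub_all HU => I /=; lra.
- by apply: sub_all HT => I /=; lra.
- by apply/andP; split; lra.
Qed.

Lemma leaf_intervals_all t a b : a < b ->
  all (fun I => a <= I.1 < b) (leaf_intervals t a b).
Proof.
move=> ab; have [c [T [-> HT]]] := leaf_intervals_cons t ab.
by rewrite /= lexx ab; apply: sub_all HT => I /=; lra.
Qed.

Lemma size_leaf_intervals t a b : size (leaf_intervals t a b) = nleaves t.
Proof. by elim: t a b => //= l IHl r IHr a b; rewrite size_cat IHl IHr. Qed.

Lemma leaf_intervals_inj t u a b : a < b ->
  leaf_intervals t a b = leaf_intervals u a b -> t = u.
Proof.
elim: t u a b => [|l IHl r IHr] [|l' r'] a b ab //.
- move=> /(congr1 size); rewrite !size_leaf_intervals /=.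
  by have := nleaves_gt0 l'; have := nleaves_gt0 r'; lia.
- move=> /(congr1 size); rewrite !size_leaf_intervals /=.
  by have := nleaves_gt0 l; have := nleaves_gt0 r; lia.
pose m := (a + b) / 2; have [am mb] : a < m /\ m < b by rewrite /m; split; lra.
(* The intervals of the two subtrees are told apart by the position of their left endpoints relative
   to the midpoint. *)
have left_part v w : leaf_intervals v a m =
    [seq I <- leaf_intervals v a m ++ leaf_intervals w m b | I.1 < m].
  rewrite filter_cat (all_filterP _) ?(eq_in_filter (a2 := pred0))
    ?filter_pred0 ?cats0 //.
    by move=> I /(allP (leaf_intervals_all w mb)) /= ?; apply/negbTE;
      rewrite -leNgt; lra.
  by apply: sub_all (leaf_intervals_all v am) => I; lra.
have right_part v w : leaf_intervals w m b =
    [seq I <- leaf_intervals v a m ++ leaf_intervals w m b | m <= I.1].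
  rewrite filter_cat [X in _ ++ X](all_filterP _) ?(eq_in_filter (a2 := pred0))
    ?filter_pred0 //.
    by move=> I /(allP (leaf_intervals_all v am)) /= ?; apply/negbTE;
      rewrite -ltNge; lra.
  by apply: sub_all (leaf_intervals_all w mb) => I; lra.
move=> E; congr Node.
  by apply: (IHl _ a m) => //;
    rewrite (left_part l r) (left_part l' r') [X in filter _ X]E.
by apply: (IHr _ m b) => //;
  rewrite (right_part l r) (right_part l' r') [X in filter _ X]E.
Qed.

Lemma carries_one e (x y : cint R) : carries 1%g e x y -> x.1 = y.1.
Proof.
case: x y => -[a b] c [[a' b'] c'] [[/= a0 /andP[ab b1]] _ _ H].
have t1 : 0 <= a < 1 by lra.
have t2 : 0 <= (a + b) / 2 < 1 by lra.
(* Fixing the left endpoint and the midpoint determines the affine image. *)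
have := H (exist _ a t1); have := H (exist _ ((a + b) / 2) t2);
  rewrite /inside /=.
move=> /(_ ltac:(lra)) H2 /(_ ltac:(lra)) H1.
have E1 : a = a' by apply/eqP; rewrite -subr_eq0; apply/eqP; nra.
by rewrite -E1 in H2 *; congr pair; nra.
Qed.

Lemma maps_one_intervals e (L M : seq (cint R)) :
  maps 1%g e L M -> [seq x.1 | x <- L] = [seq y.1 | y <- M].
Proof.
elim: L M => [|x L IH] M H; first by inversion H.
by have [y [M' [-> /carries_one /= -> /IH ->]]] := Forall2_consl H.
Qed.

Lemma maps_one e (t u : tree) s : (s < nleaves u)%N ->
  maps 1%g e (leaves R t) (rot s (leaves R u)) -> t = u /\ s = 0%N.
Proof.
move=> su H; have : leaf_intervals t 0 1 = rot s (leaf_intervals u (0 : R) 1).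
  rewrite -!(@cleaves_intervals R _ (whole R)) -map_rot.
  exact: maps_one_intervals H.
case: s su {H} => [|s] su; first by rewrite rot0 => /leaf_intervals_inj->.
have [c [T [-> _]]] := @leaf_intervals_cons t 0 1 ltr01.
have [d [U [EU HU]]] := @leaf_intervals_cons u 0 1 ltr01.
have := congr1 size EU; rewrite size_leaf_intervals EU /rot /= => sU.
have {}sU : (s < size U)%N by lia.
(* A nontrivial rotation would start with an interval whose left endpoint is positive, whereas the
   first leaf begins at 0. *)
rewrite (drop_nth (0, 0) sU).
case=> E; have := allP HU (nth (0, 0) U s);
  by rewrite mem_nth // -E => /(_ isT) /=; rewrite ltxx.
Qed.

End Faithful.

(** * Graph colourings and reduction *)

Lemma colors_first t c : exists T, colors t c = c :: T.
Proof.
elim: t c => [|l IHl r IHr] c /=; first by exists [::].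
by have [T ->] := IHl c; exists (T ++ colors r (~~ c)).
Qed.

Lemma size_colors t c : size (colors t c) = nleaves t.
Proof. by elim: t c => //= l IHl r IHr c; rewrite size_cat IHl IHr. Qed.

(** The graph is connected, so a proper 2-colouring is fixed by its value at the first vertex; the
    root edge forces the flip between the two subtrees. *)
Lemma thompson_edges_colors t k b (c : nat -> bool) :
    (forall e, e \in thompson_edges t k -> c e.1 != c e.2) ->
  forall i, i < nleaves t -> c (k + i) = c k (+) b (+) nth false (colors t b) i.
Proof.
elim: t k b => [|l IHl r IHr] k b Hc i /= it.
  by case: i it => // _; rewrite addn0 addbK.
have Hl e : e \in thompson_edges l k -> c e.1 != c e.2.
  by move=> el; apply: Hc; rewrite inE mem_cat el orbT.
have Hr e : e \in thompson_edges r (k + nleaves l) -> c e.1 != c e.2.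
  by move=> el; apply: Hc; rewrite inE mem_cat el !orbT.
rewrite nth_cat size_colors; case: ltnP => il; first exact: IHl.
have := Hc (k, k + nleaves l); rewrite inE eqxx => /(_ isT) /= ckl.
rewrite -{1}(subnKC il) addnA (IHr _ (~~ b)) //; last by lia.
have -> : c (k + nleaves l) = ~~ c k.
  by case: (c k) ckl; case: (c (k + nleaves l)).
by rewrite addNb addbN negbK.
Qed.

Lemma colors_thompson_edges t k b e : e \in thompson_edges t k ->
  [/\ k <= e.1 < k + nleaves t, k <= e.2 < k + nleaves t
    & nth false (colors t b) (e.1 - k) != nth false (colors t b) (e.2 - k)].
Proof.
elim: t k b => [|l IHl r IHr] k b //=; have l0 := nleaves_gt0 l.
have r0 := nleaves_gt0 r; rewrite inE mem_cat => /or3P[/eqP->|/IHl|/IHr] /=.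
- split; [lia|lia|]; rewrite subnn addKn !nth_cat !size_colors l0 ltnn subnn.
  by have [[T ->] [U ->]] := (colors_first l b, colors_first r (~~ b));
    case: (b).
- move=> /(_ b)[e1 e2 ne]; split; [lia|lia|]; rewrite !nth_cat !size_colors.
  by rewrite !ifT //; lia.
- move=> /(_ (~~ b))[e1 e2 ne]; split; [lia|lia|];
    rewrite !nth_cat !size_colors.
  by rewrite !ifF -?subnDA //; lia.
Qed.

Lemma leaf_carets_sub t k i : i \in leaf_carets t k ->
  k <= i /\ exists t', sub caret t' (i - k) t.
Proof.
elim: t k => // l IHl r IHr k.
have [[-> ->]|ne] : (l = Leaf /\ r = Leaf) \/
    leaf_carets (Node l r) k = leaf_carets l k ++ leaf_carets r (k + nleaves l).
- by case: (l) (r) => [|? ?] [|? ?]; [left|right..].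
- rewrite inE => /eqP->; split=> //; rewrite subnn.
  by exists Leaf; apply: SubLeaf.
rewrite ne mem_cat => /orP[/IHl[ki [l' ll']]|/IHr[ki [r' rr']]].
  by split=> //; exists (Node l' r); apply: SubL.
split; first by lia.
exists (Node l r'); have -> : i - k = nleaves l + (i - (k + nleaves l)) by lia.
exact: SubR.
Qed.

Lemma nleaves_sub u t i t' : sub u t i t' ->
  i < nleaves t /\ nleaves t' = (nleaves t + nleaves u).-1.
Proof.
have u0 := nleaves_gt0 u.
by elim=> [|l r {}i l' _ [? ?]|l r {}i r' _ [? ?]] /=; split; lia.
Qed.

Fixpoint alternates (c : bool) (s : seq bool) : bool :=
  if s is b :: s' then (b == c) && alternates (~~ c) s' else true.

Lemma alternates_cat c s1 s2 : alternates c (s1 ++ s2) =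
  alternates c s1 && alternates (c (+) odd (size s1)) s2.
Proof.
elim: s1 c => [|b s1 IH] c /=; first by rewrite addbF.
by rewrite IH andbA addNb addbN.
Qed.

Lemma alternates_rot c n s : ~~ odd (size s) -> alternates c s ->
  exists c', alternates c' (rot n s).
Proof.
move=> odd_s; rewrite -{1}(cat_take_drop n s) alternates_cat => /andP[alt1
  alt2].
exists (c (+) odd (size (take n s))); rewrite alternates_cat alt2 -addbA addbC.
by rewrite -oddD -size_cat cat_take_drop (negbTE odd_s).
Qed.

Lemma alternates_addb c e s : alternates c s ->
  alternates (c (+) e) [seq b (+) e | b <- s].
Proof.
elim: s c => //= b s IH c /andP[/eqP-> /IH]; rewrite eqxx /=.
by rewrite addNb.
Qed.

Lemma alternates_emb o c : alternates c (colors (emb o) c).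
Proof.
elim: o c => [|a IHa b IHb d IHd] c /=; first by rewrite eqxx.
rewrite !alternates_cat !size_colors !nleaves_emb /oleaves /= !oddM /= negbK.
by rewrite addbT addbT negbK IHa IHb IHd.
Qed.

Lemma alternates_femb A : alternates false (colors (femb A) false).
Proof.
rewrite /= alternates_cat alternates_emb size_colors nleaves_emb.
by rewrite /oleaves /= oddM alternates_emb.
Qed.

(** The right subtree starts with the opposite colour, so alternation forces an odd number of leaves
    on the left. An odd right subtree then gives a forest, and an even one, itself a forest,
    supplies the other two branches of a ternary caret. *)
Lemma alternating_tree t c : alternates c (colors t c) ->
  if odd (nleaves t) then exists o, t = emb o else exists A, t = femb A.
Proof.
elim: t c => [|l IHl r IHr] c /=; first by exists OLeaf.
rewrite alternates_cat size_colors => /andP[/IHl Hl altr].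
have odd_l : odd (nleaves l).
  have [T E] := colors_first r (~~ c); move: altr; rewrite E /= => /andP[].
  by case: (odd _); case: (c).
rewrite odd_l addbT in Hl altr; have [o ->] := Hl; have {IHr} := IHr _ altr.
rewrite oddD nleaves_emb /oleaves /= oddM /=.
case: (odd (nleaves r)) => -[].
  by move=> o' ->; exists (o, o').
by move=> [a b] ->; exists (ONode o a b).
Qed.

Lemma treach_node l r l' r' u : reach (sub u) l l' -> reach (sub u) r r' ->
  reach (sub u) (Node l r) (Node l' r').
Proof.
move=> ll' rr'; apply: (@reach_trans _ _ _ (Node l' r)).
  apply: (reach_map _ ll' (f := fun t => Node t r)) => x i y xy.
  by exists i; apply: SubL.
apply: (reach_map _ rr' (f := fun t => Node l' t)) => x i y xy.
by eexists; apply: SubR xy.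
Qed.

(** The two claims feed each other: an [emb] beside an [emb] is a [femb], and an [emb] beside a
    [femb] is an [emb]. *)
Lemma reach_emb t : (exists o, reach (sub caret) t (emb o)) /\
  exists A, reach (sub caret) t (femb A).
Proof.
elim: t => [|l [[o lo] _] r [[o' ro'] [[a b] rA]]].
  split; first by exists OLeaf; apply: ReachRefl.
  by exists root_forest; apply: ReachStep (SubLeaf _) (ReachRefl _ _).
split; first by exists (ONode o a b); apply: treach_node.
by exists (o, o'); apply: treach_node.
Qed.

Lemma emb_inj : injective emb.
Proof.
by elim=> [|a IHa b IHb c IHc] [|a' b' c'] //= [/IHa-> /IHb-> /IHc->].
Qed.

Lemma femb_inj : injective femb.
Proof. by move=> [l r] [l' r'] [/emb_inj-> /emb_inj->]. Qed.

(** * Triples, reduction and refinement *)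

Section Membership.
Import Order.TTheory GRing.Theory Num.Theory.
Variable R : realType.
Implicit Types (f h : circle_bij R) (t u : tree).
Local Notation leaves := (leaves R).
Local Notation whole := (whole R).

Lemma in_unit_leaves t i : i < nleaves t -> in_unit (nth whole (leaves t) i).
Proof.
move=> it; have [_] := (Forall2_nthP _ whole whole _ _).1 (maps_id R t).
by rewrite size_cleaves => /(_ i it)[].
Qed.

Lemma nth_leaves1 t i : i < nleaves t ->
  (nth whole (leaves t) i).1 = nth (0, 0)%R (leaf_intervals t 0 1)%R i.
Proof.
by move=> it; rewrite -(@cleaves_intervals R t whole) (nth_map whole)
  ?size_cleaves.
Qed.

Lemma nth_leaves2 t i : i < nleaves t ->
  (nth whole (leaves t) i).2 = nth false (colors t false) i.
Proof.
by move=> it; rewrite -(cleaves_colors t whole) (nth_map whole) ?size_cleaves.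
Qed.

Lemma nth_rot_leaves D i : is_triple D -> i < nleaves (dom_tree D) ->
  nth whole (rot (shift D).-1 (leaves (ran_tree D))) i
  = nth whole (leaves (ran_tree D)) (identified D i).
Proof.
by case=> E ? iD; rewrite nth_rot ?size_cleaves -?E //; lia.
Qed.

Lemma identified_lt D i : is_triple D -> identified D i < nleaves (ran_tree D).
Proof. by case=> <- ?; rewrite ltn_mod; lia. Qed.

Lemma represents_maps D f : is_triple D -> represents D f ->
  bipartite (thompson_graph D) ->
  exists e, maps f e (leaves (dom_tree D))
    (rot (shift D).-1 (leaves (ran_tree D))).
Proof.
move=> tD rD [c Hc]; have [ED sD] := tD.
have Hran : forall i, i < nleaves (ran_tree D) ->
    c i = c 0 (+) nth false (colors (ran_tree D) false) i.
  move=> i iD; have := @thompson_edges_colors (ran_tree D) 0 false c _ i iD.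
  rewrite add0n addbF; apply=> e eD; apply: Hc.
  by rewrite mem_cat eD orbT.
have Hdom : forall i, i < nleaves (dom_tree D) -> c (identified D i) =
    c (identified D 0) (+) nth false (colors (dom_tree D) false) i.
  move=> i iD.
  have := @thompson_edges_colors (dom_tree D) 0 false (c \o identified D) _ i
    iD.
  rewrite add0n addbF; apply=> e eD /=;
    apply: (Hc (identified D e.1, identified D e.2)).
  by rewrite mem_cat; apply/orP; left; apply/mapP; exists e.
(* This is the colour change at leaf 0 of the domain, hence at every leaf. *)
exists (c 0 (+) c (identified D 0)); apply/(Forall2_nthP _ whole whole).
rewrite size_rot !size_cleaves; split=> // i iD; rewrite nth_rot_leaves //.
have jD := identified_lt i tD; split; [exact: in_unit_leaves..| |].
  rewrite !nth_leaves2 //; move: (Hran _ jD); rewrite Hdom //.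
  set a := nth false (colors (dom_tree D) false) i;
    set b := nth false (colors (ran_tree D) false) (identified D i).
  by case: a; case: b; case: (c 0); case: (c (identified D 0)).
move=> t ti; have [_ /andP[x12 _]] := in_unit_leaves iD.
apply/slopeP => //; rewrite !nth_leaves1 //; apply: rD => //.
by rewrite -nth_leaves1.
Qed.

Lemma maps_represents f e t u s : s < nleaves t ->
  maps f e (leaves t) (rot s (leaves u)) ->
  [/\ is_triple (Triple t u s.+1), represents (Triple t u s.+1) f
    & bipartite (thompson_graph (Triple t u s.+1))].
Proof.
move=> st H; set D := Triple t u s.+1.
have [] := (Forall2_nthP _ whole whole _ _).1 H; rewrite size_rot !size_cleaves.
move=> tu {}H; have tD : is_triple D by split; rewrite /=.
have {}H i : i < nleaves t -> carries f e (nth whole (leaves t) i)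
    (nth whole (leaves u) (identified D i)).
  move=> it; have E : nth whole (rot s (leaves u)) i
    = nth whole (leaves u) (identified D i) := nth_rot_leaves tD it.
  by rewrite -E; apply: H.
split=> //.
  move=> i x it /= ti; have jD := identified_lt i tD.
  rewrite -!nth_leaves1 // in ti *; have [[_ /andP[x12 _]] _ _ Hx] := H i it.
  by apply/slopeP => //; apply: Hx.
(* Vertices are named as in the range tree, whose colouring also suits the domain edges because f
   changes all colours by the same e. *)
exists (nth false (colors u false)) => e';
  rewrite mem_cat => /orP[/mapP[d dt ->]|eu].
  have [d1 d2] := @colors_thompson_edges t 0 false d dt.
  rewrite !subn0 /= -!nth_leaves2 ?(identified_lt _ tD) //.
  case: (H d.1 _) => [|_ _ -> _]; first by lia.
  case: (H d.2 _) => [|_ _ -> _]; first by lia.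
  by rewrite (inj_eq (@addIb e)) !nth_leaves2 //; lia.
by have [_ _] := @colors_thompson_edges u 0 false e' eu; rewrite !subn0.
Qed.

Lemma maps_reduce f e t u s i j t' u' : s < nleaves t ->
    maps f e (leaves t) (rot s (leaves u)) ->
    sub caret t' i t -> sub caret u' j u -> (i + s) %% nleaves t = j ->
  exists2 s', s' < nleaves t' & maps f e (leaves t') (rot s' (leaves u')).
Proof.
move=> st H tt' uu' ij; have tu := Forall2_size H.
rewrite size_rot !size_cleaves in tu.
have [L1 [x [L2 [Et' Et sL1]]]] := cleaves_sub whole tt'.
have [M1 [y [M2 [Eu' Eu sM1]]]] := cleaves_sub whole uu'.
have [ti /= Ht] := nleaves_sub tt'; have [ui /= Hu] := nleaves_sub uu'.
have px : in_unit x.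
  have := in_unit_leaves ti; rewrite /leaves Et' nth_cat sL1 ltnn subnn.
  exact.
have py : in_unit y.
  have := in_unit_leaves ui; rewrite /leaves Eu' nth_cat sM1 ltnn subnn.
  exact.
have sM2 := congr1 size Eu; rewrite !size_cat size_cleaves /= in sM2.
have ij' : i + s = j \/ i + s = j + nleaves t.
  have := ltn_pmod (i + s) (_ : 0 < nleaves t);
    rewrite ij => /(_ ltac:(lia)) jt.
  have := divn_eq (i + s) (nleaves t); rewrite ij; case: (_ %/ _) => [|[|k]];
    nia.
(* Either s = j - i <= j, or s = j + m - i with m leaves in [t]; then i + 2 <= m gives s >= j + 2.
   In both cases the caret at j is not cut. *)
have [|N1 [N2 [EN sN1 HN]]] := @rot_block _ M1 (cleaves caret y) M2 s.
  by rewrite !size_cat /=; lia.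
have := congr1 size EN; rewrite size_rot -Eu size_cleaves !size_cat /= => sN.
rewrite !size_cat /= in sN1.
have {}H : maps f e (L1 ++ cleaves caret x ++ L2) (N1 ++ cleaves caret y ++ N2).
  by rewrite -Et -EN -Eu.
have [|H1 H2] := (maps_catP _ _ _ _ _).1 H; first by lia.
have [_ [_ [[<- <-] xyl H3]]] := Forall2_consl H2.
have [_ [_ [[<- <-] xyr H4]]] := Forall2_consl H3.
have [s0 Es0] := HN [:: y].
have [|s' s'_lt Es'] := @rot_small _ (M1 ++ [:: y] ++ M2) s0.
  by rewrite size_cat addnS.
exists s'; first by move: s'_lt; rewrite -Eu' size_cleaves; lia.
rewrite /leaves Et' Eu' -Es' Es0; apply: maps_cat H1 _.
by constructor=> //; apply: carries_join.
Qed.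

(** Common carets are removed by induction on the number of leaves until the triple is reduced; the
    property [maps] survives and ensures that the graph is bipartite. *)
Lemma maps_vecT f e t u s : s < nleaves t ->
  maps f e (leaves t) (rot s (leaves u)) -> vecT R f.
Proof.
have [n] := ubnP (nleaves t); elim: n t u s => // n IHn t u s tn st H.
have [tD rD bD] := maps_represents st H; set D := Triple t u s.+1 in tD rD bD.
have [[i [j [it ju ij _]]]|redD] := pselect (exists i j : nat,
    [/\ i \in leaf_carets (dom_tree D) 0, j \in leaf_carets (ran_tree D) 0,
      identified D i = j & identified D i.+1 = j.+1]).
  have [_ [t' tt']] := leaf_carets_sub it;
    have [_ [u' uu']] := leaf_carets_sub ju.
  rewrite !subn0 in tt' uu'.
  have [s' s't' H'] := maps_reduce st H tt' uu' ij.
  by apply: IHn s't' H'; have [] := nleaves_sub tt'; rewrite /=; lia.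
by split; [exists D|exists D; split].
Qed.

Lemma maps_reach f e t u s t' : maps f e (leaves t) (rot s (leaves u)) ->
    reach (sub caret) t t' ->
  exists u' s', maps f e (leaves t') (rot s' (leaves u')).
Proof.
move=> H tt'; elim: tt' u s H => {t t'} [t|t i t1 t' tt1 _ IH] u s H.
  by exists u, s.
have [L1 [x [L2 [Et Et1 _]]]] := cleaves_sub whole tt1.
move: H; rewrite /leaves Et -/(leaves _) => H.
have [N1 [y [N2 [EN _ H1 xy H2]]]] := maps_consr H.
have [M1 [M2 [Eu HY]]] := rot_subst EN; have [s1 Es1] := HY (cleaves caret y).
have [u1 [_ Eu1]] := leaves_sub caret Eu.
apply: (IH u1 s1); rewrite Eu1 Es1 /leaves Et1;
  apply: maps_cat H1 (maps_cat _ H2).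
exact: maps_cleaves.
Qed.

Lemma maps_colors f e L M : maps f e L M ->
  [seq y.2 | y <- M] = [seq b (+) e | b <- [seq x.2 | x <- L]].
Proof.
elim: L M => [|x L IH] M H; first by inversion H.
by have [y [M' [-> [_ _ /= -> _] /IH ->]]] := Forall2_consl H.
Qed.

(** Alternation of an even cyclic sequence survives rotation and reversal of colours, so it passes
    from the forest to [u]. *)
Lemma maps_femb f e A u s : maps f e (leaves (femb A)) (rot s (leaves u)) ->
  exists B, u = femb B.
Proof.
move=> H; have := maps_colors H; rewrite map_rot !cleaves_colors => E.
have even_u : ~~ odd (nleaves u).
  have := Forall2_size H; rewrite size_rot !size_cleaves => <-.
  by rewrite nleaves_femb fleavesE /= oddM.
have [s' Es'] := rot_inv E; have := alternates_addb e (alternates_femb A).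
move=> /(alternates_rot s'); rewrite size_map size_colors nleaves_femb fleavesE.
rewrite /= oddM => /(_ isT)[c]; rewrite Es' => alt_u.
have Ec : c = false.
  by have [T ET] := colors_first u false; move: alt_u; rewrite ET; case: (c).
rewrite Ec in alt_u; have := alternating_tree alt_u.
by rewrite (negbTE even_u).
Qed.

End Membership.

(** * Generation and completeness of the relations *)

Theorem corollary15 (R : realType) :
  finite_presentation (vecT R) (vgen_val R) vecT_rels.
Proof.
have sat := @vgen_satisfies R; split=> [h|u v].
  split=> [[_ [D [tD _ rD bD]]]|[w <-]].
    have [e H] := represents_maps tD rD bD.
    have [_ [A DA]] := reach_emb (dom_tree D).
    have [u [s {}H]] := maps_reach H DA; have [B EB] := maps_femb H.
    rewrite {}EB in H; have AB : fcarets A = fcarets B.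
      have := Forall2_size H; rewrite size_rot !size_cleaves !nleaves_femb
        !fleavesE.
      by lia.
    have [|s' s'B Es'] := @rot_small _ (leaves R (femb B)) s.
      by rewrite size_cleaves nleaves_gt0.
    rewrite size_cleaves nleaves_femb in s'B.
    (* The normal word built from the two forests of h acts on the leaves as h does, so it
       represents h. *)
    exists (normal_word A s' B); rewrite Es' in H.
    exact: maps_uniq (normal_maps R AB (ltnW s'B)) H.
  have [A [s [B [AB sB ->]]]] := normal_form sat w.
  apply: maps_vecT (normal_maps R AB (ltnW sB)).
  by rewrite nleaves_femb fleavesE AB -fleavesE.
split=> [uv|]; last exact: word_eq_val.
apply/(presented_valP vecT_rels); apply: divg1_eq.
rewrite -word_val_inv -word_val_cat.
(* The normal form is taken in the presented group. Its value on the circle is 1, which forces A = B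
   and s = 0, so it is already trivial there. *)
have [A [s [B [AB sB Ew]]]] :=
  normal_form (@presented_satisfies _ vecT_rels) (u ++ winv v).
have val1 : word_val (vgen_val R) (normal_word A s B) = 1%g.
  rewrite -(word_eq_val sat ((presented_valP _ _ _).1 Ew)).
  by rewrite word_val_cat word_val_inv uv mulgV.
have H := normal_maps R AB (ltnW sB); rewrite val1 in H.
have [|/femb_inj EAB s0] := maps_one _ H; first by rewrite nleaves_femb.
by rewrite Ew EAB s0 normal_valE mulg1 mulgV.
Qed.
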